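(* Let $I=(-1,1)$ and let $A$ be one of the four self-adjoint operators $A_{\mathtt p},A_{\mathtt a},A_{\mathtt N},A_{\mathtt D}$ in $L^2_{\mathbb{C}}(I)$ (multiples of $-d^2/dx^2$ with periodic, antiperiodic, Neumann, Dirichlet boundary conditions, respectively). Let $c\in\mathbb{R}$ and let $h:\sigma(A)\to\mathbb{R}$ be a bounded function such that $h(A)$ is Hilbert–Schmidt. Let $u_0,v_0\in L^2_{\mathbb{C}}(I)$ and let $u\in C^2(\mathbb{R},L^2_{\mathbb{C}}(I))$ be the solution of the homogeneous nonlocal wave equation $$u''(t)+(c-h(A))\,u(t)=0,\quad t\in\mathbb{R},\qquad u(0)=u_0,\quad u'(0)=v_0 .$$ Then for every $t\in\mathbb{R}$ $$u(t)=\overline{\cos(t\sqrt{\phantom{x}})}(c)\,u_0+\overline{\frac{\sin(t\sqrt{\phantom{x}})}{\sqrt{\phantom{x}}}}(c)\,v_0+\delta u(t),$$ where $\delta u(t)$ has an extension to a continuous function on $[-1,1]$. In particular, if the initial data $u_0,v_0$ are continuous on $I$, then $u(t)$ is continuous on $I$ for every $t\in\mathbb{R}$.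
   Context: Each operator is described by its eigenvectors, which form a Hilbert basis of $L^2_{\mathbb{C}}(I)$ (with $\langle g|w\rangle=\int_{-1}^1g^*w$): $A_{\mathtt p}$: $e_k(x)=\frac1{\sqrt2}e^{i\pi kx}$, $k\in\mathbb{Z}$, eigenvalue $k^2$. $A_{\mathtt a}$: $e_k(x)=\frac1{\sqrt2}e^{i\pi(k+\frac12)x}$, $k\in\mathbb{Z}$, eigenvalue $(k+\frac12)^2$. $A_{\mathtt N}$: $e_0=\frac1{\sqrt2}$, $e_k(x)=\cos(\frac{k\pi}2(x+1))$, $k\ge1$, eigenvalue $k^2$. $A_{\mathtt D}$: $e_k(x)=\sin(\frac{k\pi}2(x+1))$, $k\ge1$, eigenvalue $k^2$. For a bounded function $h$ on $\sigma(A)$, $h(A)w=\sum_kh(\lambda_k)\langle e_k|w\rangle e_k$, where $\lambda_k$ is the eigenvalue of $e_k$. $\overline{\cos(t\sqrt{\phantom{x}})}$ and $\overline{\sin(t\sqrt{\phantom{x}})/\sqrt{\phantom{x}}}$ denote the entire functions $z\mapsto\sum_{k\ge0}(-1)^k\frac{t^{2k}}{(2k)!}z^k$ and $z\mapsto\sum_{k\ge0}(-1)^k\frac{t^{2k+1}}{(2k+1)!}z^k$. Statements about continuity of $L^2$ elements refer to the existence of a continuous representative. *)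

(* Defs.v *)
From HB Require Import structures.
From mathcomp Require Import all_boot all_order all_algebra finmap complex.
From mathcomp Require Import all_classical all_reals all_analysis.
From mathcomp.analysis.showcase Require Import summability.

Set Implicit Arguments.
Unset Strict Implicit.
Unset Printing Implicit Defensive.

Import Order.TTheory GRing.Theory Num.Theory.
Import numFieldNormedType.Exports.

Local Open Scope classical_set_scope.
Local Open Scope complex_scope.
Local Open Scope ring_scope.

(* Elements of L^2_C(I) are represented by functions [R -> R[i]]; only the
   values on I matter (up to measurability on R, which every class of functions
   on I satisfies after extension by 0), since all norms, integrals and "almost
   everywhere" refer to the Lebesgue measure restricted to I. *)

Definition itvI (R : realType) : set R := `]-1, 1[%classic.
Arguments itvI : clear implicits.

Lemma measurable_itvI (R : realType) :
  measurable (itvI R : set (measurableTypeR R)).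
Proof. exact: measurable_itv. Qed.

Definition muI (R : realType) : {measure set (measurableTypeR R) -> \bar R} :=
  mrestr (@lebesgue_measure R) (@measurable_itvI R).

Definition L2norm (R : realType) (f : R -> R[i]) : \bar R :=
  ('N[@muI R]_2%:E[EFin \o (@Normc.normc R \o f)])%E.

Definition L2 (R : realType) (f : R -> R[i]) : Prop :=
  [/\ measurable_fun [set: R] (fun x => complex.Re (f x)),
      measurable_fun [set: R] (fun x => complex.Im (f x))
    & (L2norm f < +oo)%E].

Definition L2inner (R : realType) (g w : R -> R[i]) : R[i] :=
  (\int[muI R]_(x in setT) complex.Re (conjc (g x) * w x))
  +i* (\int[muI R]_(x in setT) complex.Im (conjc (g x) * w x)).

Definition hilbert_basis (R : realType) (b : nat -> R -> R[i]) : Prop :=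
  [/\ forall j, L2 (b j),
      forall j k, L2inner (b j) (b k) = (j == k)%:R
    & forall w, L2 w -> forall eps : R, 0 < eps ->
        exists n (a : 'I_n -> R[i]),
          (L2norm (fun x => w x - \sum_(j < n) a j * b j x)%R < eps%:E)%E].

(* A (possibly unbounded) operator of L^2_C(I) is given by its graph: [T w v]
   means that w is in the domain of T and T w = v. *)
Definition operator (R : realType) := (R -> R[i]) -> (R -> R[i]) -> Prop.

(* As L^2_C(I) is separable and infinite-dimensional, its Hilbert bases can be
   indexed by nat. *)
Definition hilbert_schmidt (R : realType) (T : operator R) : Prop :=
  exists b Tb : nat -> R -> R[i],
    [/\ hilbert_basis b, forall j, T (b j) (Tb j)
      & (\sum_(0 <= j <oo) (L2norm (Tb j) * L2norm (Tb j)) < +oo)%E].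

(* T - z has a bounded inverse defined on the whole space (the last clause
   contains the injectivity of T - z). *)
Definition in_resolvent (R : realType) (T : operator R) (z : R[i]) : Prop :=
  (forall f, L2 f -> exists2 w, L2 w & T w (fun x => z * w x + f x)) /\
  (exists C : R, forall w f, L2 w -> L2 f ->
     T w (fun x => z * w x + f x) -> (L2norm w <= C%:E * L2norm f)%E).

Definition spectrum (R : realType) (T : operator R) : set R[i] :=
  [set z | ~ in_resolvent T z].

Variant boundary_condition := Periodic | Antiperiodic | Neumann | Dirichlet.

Definition eigen_index (bc : boundary_condition) (k : int) : bool :=
  match bc with
  | Periodic | Antiperiodic => true
  | Neumann => 0 <= k
  | Dirichlet => 1 <= k
  end.

Definition eigval (R : realType) (bc : boundary_condition) (k : int) : R :=
  match bc with
  | Antiperiodic => (k%:~R + 2^-1) ^+ 2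
  | _ => k%:~R ^+ 2
  end.

Definition expi (R : realType) (y : R) : R[i] := cos y +i* sin y.

Definition eigvec (R : realType) (bc : boundary_condition) (k : int)
    (x : R) : R[i] :=
  match bc with
  | Periodic => (Num.sqrt 2)^-1%:C * expi (pi * k%:~R * x)
  | Antiperiodic => (Num.sqrt 2)^-1%:C * expi (pi * (k%:~R + 2^-1) * x)
  | Neumann => if k == 0 then (Num.sqrt 2)^-1%:C
               else (cos (k%:~R * pi / 2 * (x + 1)))%:C
  | Dirichlet => (sin (k%:~R * pi / 2 * (x + 1)))%:C
  end.

(* h(A) w = \sum_k h(lambda_k) <e_k|w> e_k, the family being summable in
   L^2_C(I) (limit of the finite partial sums along [totally]). Only the values
   of h at the eigenvalues are used. For unbounded h this is the operator on its
   maximal domain. *)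
Definition fun_op (R : realType) (bc : boundary_condition) (h : R -> R) :
    operator R := fun w v =>
  [/\ L2 w, L2 v &
      (fun F : {fset int} => L2norm (fun x => v x -
        \sum_(k <- F | eigen_index bc k)
          (h (eigval R bc k))%:C * L2inner (eigvec bc k) w * eigvec bc k x))
      @ totally --> 0%E].

Definition opA (R : realType) (bc : boundary_condition) : operator R :=
  fun_op bc (@id R).

Definition L2_derivative (R : realType) (u v : R -> R -> R[i]) : Prop :=
  forall t : R,
    L2norm (fun x => s^-1%:C * (u (t + s) x - u t x) - v t x)
    @[s --> (0 : R)^'] --> 0%E.

Definition L2_continuous (R : realType) (u : R -> R -> R[i]) : Prop :=
  forall t : R, L2norm (fun x => u s x - u t x) @[s --> t] --> 0%E.

Definition wave_solution (R : realType) (bc : boundary_condition) (h : R -> R)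
    (c : R) (u0 v0 : R -> R[i]) (u : R -> R -> R[i]) : Prop :=
  exists u' u'' : R -> R -> R[i],
  [/\ forall t, [/\ L2 (u t), L2 (u' t) & L2 (u'' t)],
      [/\ L2_derivative u u', L2_derivative u' u'' & L2_continuous u''],
      forall t, exists2 hu, fun_op bc h (u t) hu &
        (fun x => u'' t x + (c%:C * u t x - hu x)) = cst 0 %[ae muI R],
      u 0 = u0 %[ae muI R]
    & u' 0 = v0 %[ae muI R]].

(* The entire functions of z written cos(t sqrt z) and sin(t sqrt z) / sqrt z. *)
Definition cos_sqrt (R : realType) (t : R) (z : R[i]) : R[i] :=
  limn (series (fun k : nat =>
    (-1) ^+ k * (t ^+ (2 * k) / (2 * k)`!%:R)%:C * z ^+ k : R[i]^o)).

Definition sin_sqrt (R : realType) (t : R) (z : R[i]) : R[i] :=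
  limn (series (fun k : nat =>
    (-1) ^+ k * (t ^+ (2 * k).+1 / ((2 * k).+1)`!%:R)%:C * z ^+ k : R[i]^o)).

Definition continuous_rep (R : realType) (D : set R) (f : R -> R[i]) : Prop :=
  exists2 g : R -> R[i]^o, {within D, continuous g} & f = g %[ae muI R].

(* Main.v *)
(** Only Bessel's inequality for the eigenvectors [e_k] is needed, not their
    completeness. Parseval's identity for the Hilbert basis of the
    Hilbert-Schmidt hypothesis and Bessel's inequality for [e_k] bound
    [\sum_k h(lambda_k)^2]. Let [C], [S] be the solutions of [y'' + c y = 0] with
    Cauchy data [(1, 0)], [(0, 1)], and [w = u(T) - C(T) u_0 - S(T) v_0]. Duhamel's
    formula, paired with a fixed vector [z], gives
    [<z, w> = \int_0^T S(T - s) <z, h(A) u(s)> ds]. Taking for [z] a finite sum of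
    unimodular multiples of the [e_k] shows that [\sum_k |<e_k, w>|] is finite, so
    that [\sum_k <e_k, w> e_k] converges uniformly to a continuous function;
    taking for [z] the difference of [w] and that function, which is orthogonal to
    all [e_k], gives [<z, w> = 0], hence [<z, z> = 0].

    [L^2_C(I)] is treated as a real pre-Hilbert space for the form
    [rip f g = Re <f|g>]; the vectors [e_k] and [i e_k] then form one real
    orthonormal family. *)
Require Import Defs.
From HB Require Import structures.
From mathcomp Require Import all_boot all_order all_algebra finmap complex.
From mathcomp Require Import all_classical all_reals all_analysis.
From mathcomp.analysis.showcase Require Import summability.
From mathcomp Require Import measurable_realfun zify ring lra.
Set Implicit Arguments.
Unset Strict Implicit.
Unset Printing Implicit Defensive.

Import Order.TTheory GRing.Theory Num.Theory.
Import numFieldNormedType.Exports.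
Local Open Scope classical_set_scope.
Local Open Scope complex_scope.
Local Open Scope ring_scope.

(** * Real pre-Hilbert forms on complex vector spaces *)

(** Functions that agree almost everywhere are not identified, so the form is only semidefinite; the
    subspace is a predicate [P] because [V] contains all functions. The law [phBi] says that
    multiplication by [i] is skew-adjoint: this is the trace that sesquilinearity leaves on the real
    part of an inner product. *)
Record prehilbert (R : realType) (V : lmodType R[i]) (P : V -> Prop)
    (B : V -> V -> R) : Prop := {
  ph0 : P 0;
  phD : forall f g, P f -> P g -> P (f + g);
  phZ : forall a f, P f -> P (a *: f);
  phC : forall f g, B f g = B g f;
  phBDr : forall f g z, P f -> P g -> P z -> B z (f + g) = B z f + B z g;
  phBZr : forall (a : R) f z, P f -> P z -> B z (a%:C *: f) = a * B z f;
  phBi : forall f g, P f -> P g -> B ((0 +i* 1) *: f) g = - B f ((0 +i* 1) *: g);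
  ph_ge0 : forall f, P f -> 0 <= B f f }.

Section Prehilbert.
Variables (R : realType) (V : lmodType R[i]) (P : V -> Prop) (B : V -> V -> R).
Hypothesis PB : prehilbert P B.

Local Notation ii := ((0 +i* 1) : R[i]).

Lemma phN f : P f -> P (- f).
Proof. by rewrite -scaleN1r; exact: (phZ PB). Qed.

Lemma phB f g : P f -> P g -> P (f - g).
Proof. by move=> Pf Pg; apply: (phD PB) => //; exact: phN. Qed.

Lemma ph_sum (I : Type) (r : seq I) (Q : pred I) (F : I -> V) :
  (forall i, P (F i)) -> P (\sum_(i <- r | Q i) F i).
Proof. by move=> PF; elim/big_ind : _ => //; [exact: (ph0 PB)|exact: (phD PB)]. Qed.

Lemma phB0r z : P z -> B z 0 = 0.
Proof.
by move=> Pz; rewrite -(scale0r (0:V)) (_ : 0 = 0%:C) // (phBZr PB) ?mul0r//; exact: ph0 PB.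
Qed.

Lemma phBNr f z : P f -> P z -> B z (- f) = - B z f.
Proof.
move=> Pf Pz; rewrite -scaleN1r (_ : -1 = (-1)%:C); last by rewrite rmorphN rmorph1.
by rewrite (phBZr PB) // mulN1r.
Qed.

Lemma phBBr f g z : P f -> P g -> P z -> B z (f - g) = B z f - B z g.
Proof.
by move=> Pf Pg Pz; rewrite (phBDr PB) // ?phBNr //; exact: phN.
Qed.

Lemma phBDl f g z : P f -> P g -> P z -> B (f + g) z = B f z + B g z.
Proof. by move=> *; rewrite (phC PB) (phBDr PB) // ![B z _](phC PB). Qed.

Lemma phBBl f g z : P f -> P g -> P z -> B (f - g) z = B f z - B g z.
Proof. by move=> *; rewrite (phC PB) phBBr // ![B z _](phC PB). Qed.

Lemma phBZl (a : R) f z : P f -> P z -> B (a%:C *: f) z = a * B f z.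
Proof. by move=> *; rewrite (phC PB) (phBZr PB) // ![B z _](phC PB). Qed.

Lemma phB_sumr (I : Type) (r : seq I) (Q : pred I) (F : I -> V) z : P z ->
  (forall i, P (F i)) ->
  B z (\sum_(i <- r | Q i) F i) = \sum_(i <- r | Q i) B z (F i).
Proof.
move=> Pz PF; elim: r => [|i r ih]; first by rewrite !big_nil phB0r.
rewrite !big_cons; case: ifP => // _.
by rewrite (phBDr PB) ?ih //; exact: ph_sum.
Qed.

Lemma phB_suml (I : Type) (r : seq I) (Q : pred I) (F : I -> V) z : P z ->
  (forall i, P (F i)) ->
  B (\sum_(i <- r | Q i) F i) z = \sum_(i <- r | Q i) B (F i) z.
Proof.
move=> Pz PF; rewrite (phC PB) phB_sumr //.
by apply: eq_bigr => i _; rewrite (phC PB).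
Qed.

Lemma phBii f g : P f -> P g -> B (ii *: f) (ii *: g) = B f g.
Proof.
move=> Pf Pg; rewrite (phBi PB) // ?scalerA; last exact: (phZ PB).
rewrite (_ : ii * ii = -1); last first.
  by apply/eqP; rewrite eq_complex /=; apply/andP; split; apply/eqP; ring.
by rewrite scaleN1r phBNr // opprK.
Qed.

Lemma phBsqB f g : P f -> P g ->
  B (f - g) (f - g) = B f f - 2 * B f g + B g g.
Proof.
move=> Pf Pg; have Pfg := phB Pf Pg.
by rewrite phBBl // !phBBr // (phC PB g f); ring.
Qed.

Lemma phBsqD f g : P f -> P g ->
  B (f + g) (f + g) = B f f + 2 * B f g + B g g.
Proof.
move=> Pf Pg; have Pfg := phD PB Pf Pg.
by rewrite phBDl // !(phBDr PB) // (phC PB g f); ring.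
Qed.

(* Norms are only bounded by 1 because the enumeration [eigseq] below is padded
   with zero vectors. *)
Definition ph_orth (I : eqType) (e : I -> V) : Prop :=
  [/\ forall i, P (e i), forall i j, i != j -> B (e i) (e j) = 0
    & forall i, B (e i) (e i) <= 1].

Lemma ph_dist (I : eqType) (e : I -> V) (r : seq I) (a : I -> R) f :
  uniq r -> ph_orth e -> P f ->
  B (f - \sum_(i <- r) (a i)%:C *: e i) (f - \sum_(i <- r) (a i)%:C *: e i) =
  B f f - 2 * (\sum_(i <- r) a i * B (e i) f)
  + \sum_(i <- r) a i ^+ 2 * B (e i) (e i).
Proof.
move=> ur [Pe oe _] Pf.
have Pae i : P ((a i)%:C *: e i) by exact: (phZ PB).
have PS := ph_sum r xpredT Pae.
rewrite phBsqB // phB_sumr //; congr (_ - _ * _ + _).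
  by apply: eq_bigr => i _; rewrite (phBZr PB) // (phC PB).
rewrite phB_sumr //; apply: eq_big_seq => i ir.
rewrite (phBZr PB) // phB_suml // (bigD1_seq i) //= big1 => [|j ji].
  by rewrite phBZl // addr0; ring.
by rewrite phBZl // oe // mulr0.
Qed.

(** The vector [f - \sum B (e i) f e i] has nonnegative square. Norms below 1 only decrease the
    quadratic term of [ph_dist], so the padding is harmless. *)
Lemma ph_bessel (I : eqType) (e : I -> V) (r : seq I) f :
  uniq r -> ph_orth e -> P f ->
  \sum_(i <- r) B (e i) f ^+ 2 <= B f f.
Proof.
move=> ur oe Pf; have [Pe _ e1] := oe.
have Pae i : P ((B (e i) f)%:C *: e i) by exact: (phZ PB).
have PS := ph_sum r xpredT Pae.
have := ph_ge0 PB (phB Pf PS); rewrite ph_dist //.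
under [\sum_(i <- r) (_ * B (e i) f)]eq_bigr do rewrite -expr2.
have : \sum_(i <- r) B (e i) f ^+ 2 * B (e i) (e i) <= \sum_(i <- r) B (e i) f ^+ 2.
  by apply: ler_sum => i _; rewrite ler_piMr// sqr_ge0.
by lra.
Qed.

(** The difference of the two sides is [\sum (a i - B (e i) f)^2]. The inequality serves as a
    quantitative Parseval identity: a vector close to the span of the [e i] has a Bessel sum close
    to its squared norm. *)
Lemma ph_approx (I : eqType) (e : I -> V) (r : seq I) (a : I -> R) f :
  uniq r -> ph_orth e -> P f ->
  (forall i, B (e i) (e i) = 1) ->
  B f f <= B (f - \sum_(i <- r) (a i)%:C *: e i) (f - \sum_(i <- r) (a i)%:C *: e i)
     + \sum_(i <- r) B (e i) f ^+ 2.
Proof.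
move=> ur oe Pf e1; rewrite ph_dist // mulr_sumr.
have -> : \sum_(i <- r) a i ^+ 2 * B (e i) (e i) = \sum_(i <- r) a i ^+ 2.
  by apply: eq_bigr => i _; rewrite e1 mulr1.
rewrite -subr_ge0 [leRHS](_ : _ = \sum_(i <- r) (a i - B (e i) f) ^+ 2).
  by apply: sumr_ge0 => i _; exact: sqr_ge0.
under [in RHS]eq_bigr => i _.
  rewrite (_ : _ ^+ 2 = - (2 * (a i * B (e i) f)) + a i ^+ 2 + B (e i) f ^+2); last by ring.
  over.
rewrite !big_split /= sumrN.
by ring.
Qed.

Definition phn f := Num.sqrt (B f f).

Lemma phn_ge0 f : 0 <= phn f. Proof. exact: sqrtr_ge0. Qed.

Lemma phn_sqr f : P f -> phn f ^+ 2 = B f f.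
Proof. by move=> Pf; rewrite sqr_sqrtr //; exact: ph_ge0 PB _ Pf. Qed.

Lemma ph_CS f g : P f -> P g -> `|B f g| <= phn f * phn g.
Proof.
move=> Pf Pg.
rewrite -(@ler_pXn2r _ 2) ?nnegrE ?mulr_ge0 ?phn_ge0 // exprMn !phn_sqr //
  real_normK ?num_real //.
have key t : 0 <= B f f - 2 * (t * B f g) + t ^+ 2 * B g g.
  have Ptg : P (t%:C *: g) by exact: (phZ PB).
  have := ph_ge0 PB (phB Pf Ptg); rewrite phBsqB // (phBZr PB) // phBZl // (phBZr PB) //.
  by rewrite (expr2 t) !mulrA.
have := ph_ge0 PB Pg; rewrite le_eqVlt => /orP[/eqP g0|g0].
  (* In the degenerate case [B g g = 0] the polynomial in [t] is affine; if its slope were nonzero,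
     the value of [t] chosen next would make it [-1]. *)
  rewrite -g0 mulr0; have [->|fg0] := eqVneq (B f g) 0; first by rewrite expr0n.
  have := key ((B f f + 1) / (2 * B f g)); rewrite -g0 mulr0 addr0.
  rewrite (_ : 2 * _ = B f f + 1); last by field.
  by lra.
(* This [t] is the minimiser of the quadratic polynomial. *)
have := key (B f g / B g g).
rewrite (_ : _ + _ = (B f f * B g g - B f g ^+ 2) / B g g); last by field; rewrite gt_eqF.
by rewrite pmulr_lge0 ?invr_gt0 // subr_ge0.
Qed.

(** This is Cauchy-Schwarz for finite sums followed by Bessel's inequality. It will bound the
    pairing of [h(A) f] with a finite signed sum of eigenvectors, independently of the number of
    terms. *)
Lemma ph_bessel_CS (e : nat -> V) (a : nat -> R) (N : nat) f (H : R) :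
  ph_orth e -> P f -> \sum_(n < N) a n ^+ 2 <= H ->
  \sum_(n < N) `|a n * B (e n) f| <= Num.sqrt H * phn f.
Proof.
move=> oe Pf aH.
have bf : \sum_(n < N) B (e n) f ^+ 2 <= B f f.
  have := ph_bessel (iota_uniq 0 N) oe Pf.
  by rewrite -{1}[N]subn0 -/(index_iota 0 N) big_mkord.
have Bf := ph_ge0 PB Pf.
have H0 : 0 <= H by apply: le_trans aH; apply: sumr_ge0 => i _; exact: sqr_ge0.
(* Summing [(s |a n| - |B (e n) f|)^2 >= 0] leaves a free parameter [s], optimised below. *)
have key s : 0 <= s -> 2 * s * \sum_(n < N) `|a n * B (e n) f| <= s ^+ 2 * H + B f f.
  move=> s0; apply: (@le_trans _ _ (\sum_(n < N) (s ^+ 2 * a n ^+ 2 + B (e n) f ^+ 2))).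
    rewrite mulr_sumr; apply: ler_sum => i _; rewrite normrM.
    rewrite -(real_normK (num_real (a i))) -(real_normK (num_real (B (e i) f))).
    by have := sqr_ge0 (s * `|a i| - `|B (e i) f|); lra.
  rewrite big_split /= -mulr_sumr; apply: lerD => //.
  by apply: ler_wpM2l => //; exact: sqr_ge0.
set S := \sum_(n < N) `|_| in key *.
have S0 : 0 <= S by apply: sumr_ge0 => i _.
rewrite -(@ler_pXn2r _ 2) ?nnegrE ?mulr_ge0 ?phn_ge0 ?sqrtr_ge0 // exprMn phn_sqr //
  sqr_sqrtr //.
move: H0; rewrite le_eqVlt => /orP[/eqP H0|H0].
  have := key (B f f + 1); rewrite -H0 mul0r mulr0 add0r.
  have [->|Sn] := eqVneq S 0; first by rewrite expr0n.
  have Sp : 0 < S by rewrite lt_neqAle eq_sym Sn.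
  (* For [H = 0] and [S > 0] this choice of [s] yields the contradiction
     [2 (B f f + 1) <= B f f]. *)
  have := key ((B f f + 1) / S); rewrite -H0 mulr0 add0r.
  rewrite (_ : 2 * _ * S = 2 * (B f f + 1)); last by field.
  by move=> h _; have := h ltac:(apply: divr_ge0; lra); lra.
(* For [H > 0] the optimal parameter is [s = S / H]. *)
have := key (S / H) ltac:(exact/divr_ge0/ltW).
rewrite (_ : 2 * _ * S = 2 * (S ^+ 2 / H)); last by field; rewrite gt_eqF.
rewrite (_ : (S / H) ^+ 2 * H = S ^+ 2 / H); last by field; rewrite gt_eqF.
move=> h; have {h} : S ^+ 2 / H <= B f f by lra.
by rewrite ler_pdivrMr // mulrC.
Qed.

End Prehilbert.

(** * Derivatives and mean value bounds for real functions *)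

Lemma is_derive_cvg (R : realType) (f : R -> R) (t l : R) :
  h^-1 * (f (t + h) - f t) @[h --> 0^'] --> l -> is_derive t 1 f l.
Proof.
move=> fl.
have fl' : h^-1 *: (f (h *: 1 + t) - f t) @[h --> 0^'] --> l.
  rewrite [X in X @ _](_ : _ = (fun h => h^-1 * (f (t + h) - f t))) //.
  by apply/funext => h; rewrite [h%:A]mulr1 [h + t]addrC.
by split; [apply: cvgP fl'|exact: cvg_lim fl'].
Qed.

Lemma derive_bound (R : realType) (f f' : R -> R) (T K : R) :
  (forall s : R, is_derive s 1 f (f' s)) ->
  (forall s, `|s| <= `|T| -> `|f' s| <= K) -> `|f T - f 0| <= K * `|T|.
Proof.
move=> df bf.
have cf : continuous f.
  by move=> x; apply/differentiable_continuous/derivable1_diffP; case: (df x).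
have [T0|T0] := leP 0 T.
  have [|x] := @MVT_segment _ f f' 0 T T0 (fun x _ => df x).
    exact: continuous_subspaceT.
  rewrite in_itv /= subr0 => /andP[x0 xT] ->; rewrite normrM ler_wpM2r //.
  by apply: bf; rewrite !ger0_norm.
have [|x] := @MVT_segment _ f f' T 0 (ltW T0) (fun x _ => df x).
  exact: continuous_subspaceT.
rewrite in_itv /= sub0r distrC => /andP[x0 xT] ->; rewrite normrM normrN ler_wpM2r //.
by apply: bf; rewrite !ler0_norm ?lerN2 // ltW.
Qed.

Lemma continuous_bounded_segment (R : realType) (f : R -> R) (T : R) :
  continuous f -> exists M : R, forall s, `|s| <= `|T| -> f s <= M.
Proof.
move=> cf; have [|c _ fc] := @EVT_max R f (- `|T|) `|T| _ (continuous_subspaceT cf).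
  by rewrite ge0_cp.
by exists (f c) => s; rewrite ler_norml => sT; apply: fc; rewrite in_itv.
Qed.

(** * Differentiable curves in a pre-Hilbert space *)

Section PrehilbertCurves.
Variables (R : realType) (V : lmodType R[i]) (P : V -> Prop) (B : V -> V -> R).
Hypothesis PB : prehilbert P B.

Definition ph_quot (u v : R -> V) (t s : R) : V :=
  (s^-1)%:C *: (u (t + s) - u t) - v t.

Definition ph_deriv (u v : R -> V) : Prop :=
  forall t, phn B (ph_quot u v t s) @[s --> 0^'] --> 0.

Lemma ph_cvg0 (T : Type) (F : set_system T) {FF : Filter F} (q : T -> V) z :
  (forall s, P (q s)) -> P z -> phn B (q s) @[s --> F] --> 0 ->
  B z (q s) @[s --> F] --> 0.
Proof.
move=> Pq Pz q0; apply: norm_cvg0.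
apply: (@squeeze_cvgr _ _ _ _ (cst 0) (fun s => phn B z * phn B (q s))).
- by apply: nearW => s; rewrite normr_ge0 /= (ph_CS PB).
- exact: cvg_cst.
- by rewrite -(mulr0 (phn B z)); apply: cvgM => //; exact: cvg_cst.
Qed.

Variables u v : R -> V.
Hypotheses (Pu : forall t, P (u t)) (Pv : forall t, P (v t)).
Hypothesis uv : ph_deriv u v.

Let Pq t s : P (ph_quot u v t s).
Proof. by apply: (phB PB) => //; apply: (phZ PB); exact: (phB PB). Qed.

Let quotE (t s : R) : s != 0 -> u (t + s) = u t + s%:C *: (ph_quot u v t s + v t).
Proof.
move=> s0; rewrite /ph_quot subrK scalerA -rmorphM /= mulfV // scale1r.
by rewrite addrCA subrr addr0.
Qed.

Lemma ph_deriv_weak z (t : R) : P z -> is_derive t 1 (fun s => B z (u s)) (B z (v t)).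
Proof.
move=> Pz; apply: is_derive_cvg.
have lim_q : B z (ph_quot u v t s) + B z (v t) @[s --> 0^'] --> B z (v t).
  rewrite -[X in _ --> X]add0r; apply: cvgD; last exact: cvg_cst.
  by apply: ph_cvg0 => //; exact: uv.
apply: cvg_trans lim_q; apply: near_eq_cvg; near=> s.
have s0 : s != 0 by near: s; exact: nbhs_dnbhs_neq.
rewrite (quotE _ s0); move: (ph_quot u v t s) (Pq t s) => w Pw.
have Pwv : P (w + v t) by exact: (phD PB).
have Pswv : P (s%:C *: (w + v t)) by exact: (phZ PB).
rewrite (phBDr PB) // (phBZr PB) // (phBDr PB) //.
by field.
Unshelve. all: end_near. Qed.

(** Both slots move, so weak differentiability does not suffice: one substitutes
    [u (t + s) = u t + s (q + v t)] with [q] tending to 0 in norm and expands the square. What is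
    used later is that the squared norm is continuous, hence bounded on segments. *)
Lemma ph_deriv_sq (t : R) :
  is_derive t 1 (fun s => B (u s) (u s)) (2 * B (u t) (v t)).
Proof.
apply: is_derive_cvg.
pose q := ph_quot u v t.
have q0 z : P z -> B z (q s) @[s --> 0^'] --> 0.
  by move=> Pz; apply: ph_cvg0 => //; [move=> s; exact: Pq|exact: uv].
have qq : B (q s) (q s) @[s --> 0^'] --> 0.
  have : phn B (q s) * phn B (q s) @[s --> 0^'] --> (0 * 0 : R) by apply: cvgM; exact: uv.
  rewrite mulr0; apply: cvg_trans; apply: near_eq_cvg; apply: nearW => s.
  by rewrite -expr2 (phn_sqr PB) //; exact: Pq.
have lim_q : 2 * B (u t) (q s) + 2 * B (u t) (v t) +
    s * (B (q s) (q s) + 2 * B (v t) (q s) + B (v t) (v t)) @[s --> 0^'] -->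
    (2 * 0 + 2 * B (u t) (v t) + 0 * (0 + 2 * 0 + B (v t) (v t)) : R).
  apply: cvgD.
    apply: cvgD; last exact: cvg_cst.
    by apply: cvgM; [exact: cvg_cst|exact: q0].
  apply: cvgM; first exact: cvg_within.
  apply: cvgD; last exact: cvg_cst.
  apply: cvgD => //.
  by apply: cvgM; [exact: cvg_cst|exact: q0].
rewrite mulr0 add0r mul0r addr0 in lim_q; apply: cvg_trans lim_q; apply: near_eq_cvg; near=> s.
have s0 : s != 0 by near: s; exact: nbhs_dnbhs_neq.
rewrite (quotE _ s0) /q; move: (ph_quot u v t s) (Pq t s) => w Pw.
have Pwv : P (w + v t) by exact: (phD PB).
have Pswv : P (s%:C *: (w + v t)) by exact: (phZ PB).
rewrite (phBsqD PB (Pu t) Pswv) !(phBZr PB) // (phBZl PB) //.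
rewrite (phBDr PB) // (phBsqD PB) // (phC PB w).
by field.
Unshelve. all: end_near. Qed.

Lemma ph_deriv_bounded (T : R) :
  exists M : R, forall s, `|s| <= `|T| -> phn B (u s) <= M.
Proof.
have [M hM] : exists M : R, forall s, `|s| <= `|T| -> B (u s) (u s) <= M.
  apply: continuous_bounded_segment => x.
  by apply/differentiable_continuous/derivable1_diffP; case: (ph_deriv_sq x).
(* For the norm [x], [(x - 1)^2 >= 0] gives [2 x <= 1 + x^2 <= 1 + M]. *)
exists (1 + M) => s /hM {}hM.
have : phn B (u s) ^+ 2 <= M by rewrite (phn_sqr PB).
by have := sqr_ge0 (phn B (u s) - 1); rewrite expr2; nra.
Qed.

End PrehilbertCurves.

(** * Duhamel's formula *)

Section Duhamel.
Variables (R : realType) (V : lmodType R[i]) (P : V -> Prop) (B : V -> V -> R).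
Hypothesis PB : prehilbert P B.
Variables (c : R) (Cc Sc : R -> R).
Hypotheses (dC : forall s : R, is_derive s 1 Cc (- c * Sc s))
  (dS : forall s : R, is_derive s 1 Sc (Cc s)) (C0 : Cc 0 = 1) (S0 : Sc 0 = 0).
Variables u u1 u2 hu : R -> V.
Hypotheses (Pu : forall t, P (u t)) (Pu1 : forall t, P (u1 t))
  (Pu2 : forall t, P (u2 t)).
Hypotheses (du : ph_deriv B u u1) (du1 : ph_deriv B u1 u2).
Hypothesis weq : forall z t, P z -> B z (u2 t) = - c * B z (u t) + B z (hu t).

(* The function [s |-> <z, u s> C(T - s) + <z, u' s> S(T - s)] equals [<z, u T>]
   at [T], has value [C(T) <z, u 0> + S(T) <z, u' 0>] at [0], and its derivative
   is [<z, hu s> S(T - s)]. *)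
Lemma duhamel_bound (T : R) : exists2 K : R, 0 <= K &
  forall (z : V) (b : R), P z -> 0 <= b ->
  (forall s, `|B z (hu s)| <= b * phn B (u s)) ->
  `|B z (u T - (Cc T)%:C *: u 0 - (Sc T)%:C *: u1 0)| <= K * b.
Proof.
have [M hM] := ph_deriv_bounded PB Pu Pu1 du T.
have [N hN] : exists N : R, forall s, `|s| <= `|T| -> `|Sc (T - s)| <= N.
  apply: continuous_bounded_segment => x; apply: cvg_norm.
  apply: (@continuous_comp _ _ _ (fun s => T - s) Sc).
    by apply: cvgB; [exact: cvg_cst|exact: cvg_id].
  by apply/differentiable_continuous/derivable1_diffP; case: (dS (T - x)).
have M0 : 0 <= M by apply: le_trans (hM 0 _); rewrite ?phn_ge0 // normr0.
have N0 : 0 <= N by apply: le_trans (hN 0 _); rewrite ?normr0.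
(* [M] bounds the norm of [u s] and [N] bounds [|S(T - s)|] for [|s| <= |T|]. The constant is fixed
   before [z] and [b], so one bound serves all finite sums of eigenvectors as well as the case
   [b = 0]. *)
exists (M * N * `|T|); first by rewrite !mulr_ge0.
move=> z b Pz b0 zb.
pose phi s := B z (u s) * Cc (T - s) + B z (u1 s) * Sc (T - s).
have dphi (s : R) : is_derive s 1 phi (B z (hu s) * Sc (T - s)).
  have d1 := ph_deriv_weak PB Pu Pu1 du s Pz.
  have d2 := ph_deriv_weak PB Pu1 Pu2 du1 s Pz.
  have dT : is_derive s 1 (fun s : R => T - s) (- 1).
    by rewrite -[- 1]add0r; apply: is_deriveB.
  have dCT : is_derive s 1 (fun s : R => Cc (T - s)) (c * Sc (T - s)).
    by have := @is_derive1_comp _ Cc (fun s => T - s) s _ _ (dC (T - s)) dT;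
      rewrite mulrN1 mulNr opprK.
  have dST : is_derive s 1 (fun s : R => Sc (T - s)) (- Cc (T - s)).
    by have := @is_derive1_comp _ Sc (fun s => T - s) s _ _ (dS (T - s)) dT;
      rewrite mulrN1.
  have dM := is_deriveD (is_deriveM d1 dCT) (is_deriveM d2 dST).
  apply: (@is_derive_eq _ _ _ phi _ _ _ _ dM); rewrite /GRing.scale /= weq //.
  by ring.
have PCS : P ((Cc T)%:C *: u 0) /\ P ((Sc T)%:C *: u1 0).
  by split; exact: (phZ PB).
have -> : B z (u T - (Cc T)%:C *: u 0 - (Sc T)%:C *: u1 0) = phi T - phi 0.
  case: PCS => PC PS; rewrite !(phBBr PB) //; last exact: (phB PB).
  rewrite !(phBZr PB) // /phi subrr subr0 C0 S0.
  by ring.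
(* The mean value inequality for [phi] takes the place of the integral in Duhamel's formula. *)
rewrite mulrAC; apply: derive_bound dphi _ => s sT.
rewrite normrM (mulrC M) -mulrA mulrC.
apply: ler_pM => //; first exact: hN.
rewrite mulrC; apply: le_trans (zb s) _.
by apply: ler_wpM2l => //; exact: hM.
Qed.

End Duhamel.

(** * Hilbert-Schmidt operators *)

Section HilbertSchmidt.
Variables (R : realType) (V : lmodType R[i]) (P : V -> Prop) (B : V -> V -> R).
Hypothesis PB : prehilbert P B.
Variables (e b tb : nat -> V) (hh : nat -> R) (H : R).
Hypotheses (oe : ph_orth P B e) (ob : ph_orth P B b)
  (b1 : forall j, B (b j) (b j) = 1) (Ptb : forall j, P (tb j)).
Hypothesis e1 : forall n, hh n = 0 \/ B (e n) (e n) = 1.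
Hypothesis b_total : forall n, exists m (a : nat -> R),
  B (e n - \sum_(j <- iota 0 m) (a j)%:C *: b j)
    (e n - \sum_(j <- iota 0 m) (a j)%:C *: b j) <= 2^-1.
Hypothesis tbE : forall j n, B (e n) (tb j) = hh n * B (e n) (b j).
Hypothesis tbH : forall m, \sum_(j <- iota 0 m) B (tb j) (tb j) <= H.

(** If [e n] has norm 1, it lies at squared distance at most 1/2 from a finite combination of the
    [b j], so by [ph_approx] finitely many [B (e n) (b j) ^+ 2] sum to at least 1/2. Multiplying by
    [hh n ^+ 2] turns [b j] into [tb j] at the cost of a factor 2; summing over [n], exchanging the
    sums and applying Bessel's inequality to each [tb j] gives the bound. *)
Lemma hilbert_schmidt_sum N : \sum_(n <- iota 0 N) hh n ^+ 2 <= 2 * H.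
Proof.
have Pe n : P (e n) by case: oe.
have key n : exists m, hh n ^+ 2 <= 2 * \sum_(j <- iota 0 m) B (e n) (tb j) ^+ 2.
  have [hn0|en1] := e1 n.
    exists 0%N; rewrite hn0 expr0n /= big_nil mulr0 //.
  have [m [a ha]] := b_total n; exists m.
  have := ph_approx PB a (iota_uniq 0 m) ob (Pe n) b1.
  under [X in 2 * X]eq_bigr do rewrite tbE exprMn.
  rewrite -mulr_sumr en1.
  rewrite (_ : \sum_(j <- _) B (b j) _ ^+ 2 = \sum_(j <- iota 0 m) B (e n) (b j) ^+ 2); last first.
    by apply: eq_bigr => j _; rewrite (phC PB).
  set S := \sum_(j <- _) B _ _ ^+ 2 => h1.
  have S2 : 1 <= 2 * S by lra.
  by rewrite mulrCA ler_peMr // sqr_ge0.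
have [f hf] := choice key.
(* A cutoff common to the first [N] indices allows the exchange of the two sums. *)
pose M := (\max_(n < N) f n)%N.
have mono n : (n < N)%N -> hh n ^+ 2 <= 2 * \sum_(j <- iota 0 M) B (e n) (tb j) ^+ 2.
  move=> nN; apply: le_trans (hf n) _; apply: ler_wpM2l => //.
  have fM : (f n <= M)%N by exact: (@leq_bigmax _ (fun n : 'I_N => f n) (Ordinal nN)).
  rewrite -(subnKC fM) iotaD big_cat /= lerDl.
  by apply: sumr_ge0 => j _; exact: sqr_ge0.
apply: (@le_trans _ _ (\sum_(n <- iota 0 N) 2 * \sum_(j <- iota 0 M) B (e n) (tb j) ^+ 2)).
  rewrite big_seq [leRHS]big_seq; apply: ler_sum => n.
  by rewrite mem_iota => nN; exact: mono.
rewrite -mulr_sumr exchange_big /=; apply: ler_wpM2l => //.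
apply: le_trans (tbH M); apply: ler_sum => j _.
exact: (ph_bessel PB (iota_uniq 0 N) oe (Ptb j)).
Qed.

End HilbertSchmidt.

(** * The entire functions of the wave equation *)

Section WaveSeries.
Variables (R : realType) (c : R).

(** The entire functions of the statement are series in [z]. For the fixed value [z = c] they are
    rewritten as power series in [t], with zero coefficients at the missing parity, so that termwise
    differentiation applies. *)
Definition wave_cos_coef (n : nat) : R :=
  (~~ odd n)%:R * (- c) ^+ n./2 / n`!%:R.
Definition wave_sin_coef (n : nat) : R :=
  (odd n)%:R * (- c) ^+ n.-1./2 / n`!%:R.

Definition wave_cos (t : R) : R := limn (pseries wave_cos_coef t).
Definition wave_sin (t : R) : R := limn (pseries wave_sin_coef t).

Lemma diffs_wave_sin : pseries_diffs wave_sin_coef = wave_cos_coef.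
Proof.
apply/funext => i; rewrite /pseries_diffs /wave_sin_coef /wave_cos_coef /= factS natrM invfM.
by rewrite [_.+1%:R * _]mulrC -!mulrA [_.+1%:R^-1 * _]mulrC mulfK.
Qed.

Lemma diffs_wave_cos :
  pseries_diffs wave_cos_coef = (fun n => - c * wave_sin_coef n).
Proof.
apply/funext => -[|i]; rewrite /pseries_diffs /wave_sin_coef /wave_cos_coef /=.
  by rewrite !mul0r !mulr0.
rewrite negbK exprS factS natrM invfM.
rewrite [_.+1%:R * _]mulrC -!mulrA [_.+1%:R^-1 * _]mulrC mulfK //.
by rewrite mulrCA.
Qed.

(** Since [K >= 1], the power of [|c|] in the [n]-th coefficient is at most [K ^+ n], although its
    exponent is only about [n / 2]. The exponential series at [K |t|] then dominates. *)
Let K := Num.max 1 `|c|.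

Let cK m n : (m <= n)%N -> `|(- c) ^+ m| <= K ^+ n.
Proof.
move=> mn; rewrite normrX normrN; apply: (@le_trans _ _ (K ^+ m)).
  by apply: lerXn2r; rewrite ?nnegrE ?le_max ?ler01 ?lexx ?orbT.
by apply: ler_weXn2l => //; rewrite le_max lexx.
Qed.

Let cvg_le_exp (a : nat -> R) t : (forall n, `|a n| <= K ^+ n / n`!%:R) ->
  cvgn (pseries a t).
Proof.
move=> aK; apply: normed_cvg.
apply: series_le_cvg; last exact: (is_cvg_series_exp_coeff (K * `|t|)).
- by move=> n; rewrite normr_ge0.
- move=> n; rewrite /exp_coeff /= divr_ge0 // exprn_ge0 // mulr_ge0 //.
  by rewrite le_max ler01.
- move=> n; rewrite /exp_coeff /= normrM normrX exprMn mulrAC.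
  by rewrite ler_wpM2r // exprn_ge0.
Qed.

Lemma is_cvg_wave_cos t : cvgn (pseries wave_cos_coef t).
Proof.
apply: cvg_le_exp => n; rewrite /wave_cos_coef !normrM normfV !normr_nat.
rewrite ler_wpM2r // ?invr_ge0 //.
case: odd => /=; first by rewrite mul0r exprn_ge0 // le_max ler01.
by rewrite mul1r cK // leq_half_double -addnn leqW ?leq_addr.
Qed.

Lemma is_cvg_wave_sin t : cvgn (pseries wave_sin_coef t).
Proof.
apply: cvg_le_exp => n; rewrite /wave_sin_coef !normrM normfV !normr_nat.
rewrite ler_wpM2r // ?invr_ge0 //.
case: odd => /=; last by rewrite mul0r exprn_ge0 // le_max ler01.
rewrite mul1r cK // (leq_trans _ (leq_pred n)) //.
by rewrite leq_half_double -addnn leqW ?leq_addr.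
Qed.

Lemma pseriesZ (a : nat -> R) k t :
  pseries (fun n => k * a n) t = (fun n => k * pseries a t n).
Proof.
apply/funext => n; rewrite /pseries /series /= mulr_sumr.
by apply: eq_bigr => i _; rewrite mulrA.
Qed.

Lemma is_derive_wave_sin (t : R) : is_derive t 1 wave_sin (wave_cos t).
Proof.
(* Termwise differentiation at [t] asks for convergence at a point of larger modulus; [|t| + 1] is
   one. *)
have := @pseries_snd_diffs R wave_sin_coef (`|t| + 1) t.
rewrite diffs_wave_sin; apply.
- exact: is_cvg_wave_sin.
- exact: is_cvg_wave_cos.
- rewrite diffs_wave_cos pseriesZ; apply: is_cvgM; first exact: is_cvg_cst.
  exact: is_cvg_wave_sin.
- by rewrite [ltRHS]ger0_norm ?ltrDl // addr_ge0.
Qed.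

Lemma is_derive_wave_cos (t : R) : is_derive t 1 wave_cos (- c * wave_sin t).
Proof.
have := @pseries_snd_diffs R wave_cos_coef (`|t| + 1) t.
have cs k : cvgn (pseries (fun n => k * wave_sin_coef n) (`|t| + 1)).
  rewrite pseriesZ; apply: is_cvgM; first exact: is_cvg_cst.
  exact: is_cvg_wave_sin.
rewrite diffs_wave_cos [limn (pseries (fun n => _) t)](_ : _ = - c * wave_sin t); last first.
  rewrite pseriesZ; apply/cvg_lim => //; apply: cvgM; first exact: cvg_cst.
  exact: is_cvg_wave_sin.
apply.
- exact: is_cvg_wave_cos.
- exact: cs.
- rewrite (_ : pseries_diffs _ = (fun n => - c * wave_cos_coef n)).
    rewrite pseriesZ; apply: is_cvgM; first exact: is_cvg_cst.
    exact: is_cvg_wave_cos.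
  rewrite -diffs_wave_sin; apply/funext => n.
  by rewrite /pseries_diffs mulrCA.
- by rewrite [ltRHS]ger0_norm ?ltrDl // addr_ge0.
Qed.

Lemma wave_sin0 : wave_sin 0 = 0.
Proof.
apply/cvg_lim => //; apply: (@cvg_trans _ (cst 0 @ \oo)); last exact: cvg_cst.
apply: near_eq_cvg; apply: nearW => n; rewrite /pseries /series /= big1 // => i _.
by rewrite /wave_sin_coef; case: i => [|i]; rewrite ?mul0r // expr0n mulr0.
Qed.

Lemma wave_cos0 : wave_cos 0 = 1.
Proof.
(* The empty partial sum is 0 rather than 1, hence the shift of the sequence by one. *)
apply/cvg_lim => //; rewrite -cvg_shiftS.
apply: (@cvg_trans _ (cst 1 @ \oo)); last exact: cvg_cst.
apply: near_eq_cvg; apply: nearW => n; rewrite /pseries /series /= big_nat_recl // big1 => [|i _].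
  by rewrite /wave_cos_coef /= fact0 divr1 !mulr1 addr0.
by rewrite expr0n mulr0.
Qed.

(** Grouping the power series in [t] by consecutive pairs, each with exactly one nonzero term,
    recovers the series in [z] at [z = c]. *)
Lemma cvg_wave_cos_group t :
  series (fun k => (-1) ^+ k * (t ^+ (2 * k) / (2 * k)`!%:R) * c ^+ k) @ \oo -->
  wave_cos t.
Proof.
have /(@cvg_series_cvg_series_group _ _ 2) := @is_cvg_wave_cos t.
move=> /(_ isT); apply: cvg_trans; apply: near_eq_cvg; apply: nearW => n.
rewrite /series /=; apply: eq_bigr => i _; rewrite !muln2.
rewrite big_nat_recr //= big_nat1 /wave_cos_coef /= odd_double /= !mul0r addr0.
rewrite ?doubleK ?half_bit_double (exprNn c) mul2n mul1r; move: (_`!%:R^-1) => w; ring.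
Qed.

Lemma cvg_wave_sin_group t :
  series (fun k => (-1) ^+ k * (t ^+ (2 * k).+1 / ((2 * k).+1)`!%:R) * c ^+ k) @ \oo -->
  wave_sin t.
Proof.
have /(@cvg_series_cvg_series_group _ _ 2) := @is_cvg_wave_sin t.
move=> /(_ isT); apply: cvg_trans; apply: near_eq_cvg; apply: nearW => n.
rewrite /series /=; apply: eq_bigr => i _; rewrite !muln2.
rewrite big_nat_recr //= big_nat1 /wave_sin_coef /= odd_double /= !mul0r add0r.
rewrite ?doubleK ?half_bit_double (exprNn c) mul2n mul1r; move: (_`!%:R^-1) => w; ring.
Qed.

End WaveSeries.

Lemma cvg_real_complex (R : realType) (T : Type) (F : set_system T)
    {FF : Filter F} (f : T -> R) (l : R) :
  f @ F --> l -> ((fun x => (f x)%:C) : T -> R[i]^o) @ F --> (l%:C : R[i]^o).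
Proof.
move=> fl; apply/cvgrPdist_lt => -[e e'] /=; rewrite ltcE /= => /andP[/eqP -> e0].
have /cvgrPdist_lt/(_ e e0) := fl.
apply: filterS => x /= flx.
rewrite -rmorphB /= normc_def /= expr0n addr0 sqrtr_sqr.
by rewrite ltcR.
Qed.

Lemma cos_sqrt_real (R : realType) (t c : R) :
  cos_sqrt t c%:C = (wave_cos c t)%:C.
Proof.
rewrite /cos_sqrt; apply: (@cvg_lim (R[i]^o : normedModType R[i])) => //.
apply: cvg_trans (cvg_real_complex (@cvg_wave_cos_group R c t)).
apply: near_eq_cvg; apply: nearW => n; rewrite /series /= rmorph_sum /=.
by apply: eq_bigr => i _; rewrite !rmorphM !rmorphXn /= rmorphN rmorph1.
Qed.

Lemma sin_sqrt_real (R : realType) (t c : R) :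
  sin_sqrt t c%:C = (wave_sin c t)%:C.
Proof.
rewrite /sin_sqrt; apply: (@cvg_lim (R[i]^o : normedModType R[i])) => //.
apply: cvg_trans (cvg_real_complex (@cvg_wave_sin_group R c t)).
apply: near_eq_cvg; apply: nearW => n; rewrite /series /= rmorph_sum /=.
by apply: eq_bigr => i _; rewrite !rmorphM !rmorphXn /= rmorphN rmorph1.
Qed.

(** * The space of square integrable functions *)

Definition rip (R : realType) (f g : R -> R[i]^o) : R :=
  \int[muI R]_(x in setT)
    (complex.Re (f x) * complex.Re (g x) + complex.Im (f x) * complex.Im (g x)).

Lemma muI_fin (R : realType) : (muI R setT < +oo)%E.
Proof.
rewrite /muI /= /mrestr setTI lebesgue_measure_itv /= lte_fin.
by case: ifP => // _; rewrite -EFinD ltry.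
Qed.

Lemma ae_muIS (R : realType) (P Q : R -> Prop) : (forall x, P x -> Q x) ->
  {ae muI R, forall x, P x} -> {ae muI R, forall x, Q x}.
Proof. by move=> PQ; exact: (@filterS _ _ (ae_filter_ringOfSetsType (muI R))). Qed.

Section L2Space.
Variable R : realType.
Implicit Types (f g w : R -> R[i]^o).

Definition sqc f (x : R) : R := complex.Re (f x) ^+ 2 + complex.Im (f x) ^+ 2.

Lemma sqc_ge0 f x : 0 <= sqc f x.
Proof. by rewrite addr_ge0 // sqr_ge0. Qed.

Lemma L2normE f :
  L2norm f = ((\int[muI R]_(x in setT) (sqc f x)%:E) `^ 2^-1)%E.
Proof.
rewrite /L2norm unlock; congr (_ `^ _)%E.
apply: eq_integral => x _ /=; rewrite /Normc.normc /sqc.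
case: (f x) => a b /=.
by rewrite ger0_norm ?sqrtr_ge0 // powR_mulrn ?sqrtr_ge0 // sqr_sqrtr // addr_ge0 // sqr_ge0.
Qed.

Definition cmeas f : Prop :=
  measurable_fun [set: R] (fun x => complex.Re (f x)) /\
  measurable_fun [set: R] (fun x => complex.Im (f x)).

Lemma measurable_sqc f : cmeas f -> measurable_fun [set: R] (sqc f).
Proof.
by move=> [mr mi]; apply: measurable_funD; apply: measurable_funX.
Qed.

Lemma L2P f : L2 f <->
  cmeas f /\ (muI R).-integrable setT (EFin \o sqc f).
Proof.
have iE : (\int[muI R]_(x in setT) `|(EFin \o sqc f) x| =
    \int[muI R]_(x in setT) (sqc f x)%:E)%E.
  by apply: eq_integral => x _ /=; rewrite ger0_norm // sqc_ge0.
split=> [[mr mi fy]|[[mr mi] /integrableP[_ fi]]].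
  split=> //; apply/integrableP; split.
    by apply/measurable_EFinP; exact: measurable_sqc.
  by rewrite iE; move: fy; rewrite L2normE; apply: lty_poweRy.
by split=> //; rewrite L2normE; apply: poweR_lty; rewrite -iE.
Qed.

Lemma L2_le f g : cmeas f -> L2 g ->
  (exists K : R, forall x, sqc f x <= K * sqc g x) -> L2 f.
Proof.
move=> mf /L2P[mg ig] [K fg]; apply/L2P; split => //.
apply: (le_integrable _ _ _ (integrableZl _ K ig)) => //.
  by apply/measurable_EFinP; exact: measurable_sqc.
move=> x _ /=; rewrite lee_fin ger0_norm ?sqc_ge0 //.
by apply: le_trans (fg x) _; exact: ler_norm.
Qed.

Lemma measurable_rip f g : cmeas f -> cmeas g -> measurable_fun [set: R]
  (fun x => complex.Re (f x) * complex.Re (g x) + complex.Im (f x) * complex.Im (g x)).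
Proof.
by move=> [? ?] [? ?]; apply: measurable_funD; apply: measurable_funM.
Qed.

Lemma rip_integrable f g : L2 f -> L2 g -> (muI R).-integrable setT (EFin \o
  (fun x => complex.Re (f x) * complex.Re (g x) + complex.Im (f x) * complex.Im (g x))).
Proof.
move=> /L2P[mf jf] /L2P[mg jg].
apply: (le_integrable _ _ _ (integrableD _ jf jg)) => //.
  by apply/measurable_EFinP; exact: measurable_rip.
move=> x _ /=; rewrite lee_fin [leRHS]ger0_norm ?addr_ge0 ?sqr_ge0 //.
rewrite /sqc; move: (complex.Re (f x)) (complex.Im (f x)) (complex.Re (g x)) (complex.Im (g x)).
move=> a b p q; rewrite ler_norml; apply/andP; split.
  by have := sqr_ge0 (a + p); have := sqr_ge0 (b + q);
     have := sqr_ge0 a; have := sqr_ge0 b; have := sqr_ge0 p; have := sqr_ge0 q; lra.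
by have := sqr_ge0 (a - p); have := sqr_ge0 (b - q);
     have := sqr_ge0 a; have := sqr_ge0 b; have := sqr_ge0 p; have := sqr_ge0 q; lra.
Qed.

Lemma L2_bounded f : cmeas f -> (exists K : R, forall x, sqc f x <= K) -> L2 f.
Proof.
move=> mf [K fK]; apply/L2P; split => //.
apply: measurable_bounded_integrable => //; first exact: muI_fin.
  exact: measurable_sqc.
exists K; split; first by rewrite num_real.
by move=> M KM x _; rewrite /= ger0_norm ?sqc_ge0 // (le_trans (fK x)) // ltW.
Qed.

Lemma L2D f g : L2 f -> L2 g -> L2 (f + g : R -> R[i]^o).
Proof.
move=> /L2P[[mf1 mf2] jf] /L2P[[mg1 mg2] jg]; apply/L2P.
have mfg : cmeas (f + g : R -> R[i]^o).
  split.
    rewrite (_ : (fun x => _) = (fun x => complex.Re (f x) + complex.Re (g x))).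
      exact: measurable_funD.
    by apply/funext => x; rewrite /= -raddfD.
  rewrite (_ : (fun x => _) = (fun x => complex.Im (f x) + complex.Im (g x))).
    exact: measurable_funD.
  by apply/funext => x; rewrite /= -raddfD.
split => //.
have := integrableD _ (integrableZl _ 2 jf) (integrableZl _ 2 jg).
move=> /(_ measurableT measurableT measurableT); apply: le_integrable => //.
  by apply/measurable_EFinP; exact: measurable_sqc.
move=> x _ /=; rewrite lee_fin ger0_norm ?sqc_ge0 // ger0_norm.
  rewrite /sqc /= !raddfD /=.
  have := sqr_ge0 (complex.Re (f x) - complex.Re (g x)).
  have := sqr_ge0 (complex.Im (f x) - complex.Im (g x)).
  by lra.
by rewrite addr_ge0 // mulr_ge0 // sqc_ge0.
Qed.

Lemma sqcZ (a : R[i]) f x :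
  sqc (a *: f : R -> R[i]^o) x = (complex.Re a ^+ 2 + complex.Im a ^+ 2) * sqc f x.
Proof.
rewrite /sqc (_ : (a *: f : R -> R[i]^o) x = a * f x) //.
by case: (f x) a => p q [a b] /=; ring.
Qed.

Lemma L2Z (a : R[i]) f : L2 f -> L2 (a *: f : R -> R[i]^o).
Proof.
move=> Lf; apply: (L2_le _ Lf); last first.
  by exists (complex.Re a ^+ 2 + complex.Im a ^+ 2) => x; rewrite sqcZ.
case/L2P : Lf => -[mf1 mf2] _; split.
  rewrite (_ : (fun x => _) =
    (fun x => complex.Re a * complex.Re (f x) - complex.Im a * complex.Im (f x))).
    by apply: measurable_funB; apply: measurable_funM => //; exact: measurable_cst.
  apply/funext => x; rewrite (_ : (a *: f : R -> R[i]^o) x = a * f x) //.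
  by case: (f x) a => p q [c d].
rewrite (_ : (fun x => _) =
  (fun x => complex.Re a * complex.Im (f x) + complex.Im a * complex.Re (f x))).
  by apply: measurable_funD; apply: measurable_funM => //; exact: measurable_cst.
apply/funext => x; rewrite (_ : (a *: f : R -> R[i]^o) x = a * f x) //.
by case: (f x) a => p q [c d].
Qed.

Lemma L2_0 : L2 (0 : R -> R[i]^o).
Proof.
apply: L2_bounded; first by split; exact: measurable_cst.
by exists 0 => x; rewrite /sqc /= expr0n addr0.
Qed.

Lemma rip_prehilbert : prehilbert (V := R -> R[i]^o) (@L2 R) (@rip R).
Proof.
split.
- exact: L2_0.
- exact: L2D.
- exact: L2Z.
- by move=> f g; apply: eq_Rintegral => x _; rewrite mulrC [X in _ + X]mulrC.
- move=> f g z Lf Lg Lz; rewrite /rip.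
  rewrite -RintegralD //; [|exact: rip_integrable..].
  by apply: eq_Rintegral => x _; rewrite /= !raddfD /=; ring.
- move=> a f z Lf Lz; rewrite /rip -RintegralZl //; last exact: rip_integrable.
  apply: eq_Rintegral => x _; rewrite (_ : (a%:C *: f) x = a%:C * f x) //.
  by case: (f x) => p q /=; ring.
- move=> f g Lf Lg; rewrite /rip -mulN1r -RintegralZl //; last first.
    by apply: rip_integrable => //; exact: L2Z.
  apply: eq_Rintegral => x _; rewrite (_ : ((0 +i* 1) *: f) x = (0 +i* 1) * f x) //.
  rewrite (_ : ((0 +i* 1) *: g) x = (0 +i* 1) * g x) //.
  by case: (f x) (g x) => p q [a b] /=; ring.
- move=> f Lf; apply: Rintegral_ge0 => x _; rewrite -!expr2; exact: sqc_ge0.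
Qed.

Lemma ripE f : L2 f -> (\int[muI R]_(x in setT) (sqc f x)%:E = (rip f f)%:E)%E.
Proof.
move=> Lf; rewrite /rip /Rintegral fineK.
  by apply: eq_integral => x _; rewrite /sqc !expr2.
apply: integrable_fin_num => //; have := rip_integrable Lf Lf; done.
Qed.

Lemma L2norm_phn f : L2 f -> L2norm f = (phn (@rip R) f)%:E.
Proof.
move=> Lf; rewrite L2normE ripE // poweR_EFin powR12_sqrt //.
exact: (ph_ge0 rip_prehilbert).
Qed.

Lemma rip_eq0 f : L2 f -> rip f f = 0 -> f = (fun=> 0) %[ae muI R].
Proof.
move=> Lf f0; have /L2P[mf _] := Lf.
have : (\int[muI R]_(x in setT) `|(EFin \o sqc f) x| = 0)%E.
  rewrite -[RHS](congr1 EFin f0) -ripE //; apply: eq_integral => x _ /=.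
  by rewrite ger0_norm // sqc_ge0.
move/(ae_eq_integral_abs (muI R) measurableT).
have mE : measurable_fun setT (EFin \o sqc f).
  by apply/measurable_EFinP; exact: measurable_sqc.
move=> /(_ mE); apply: ae_muIS => x /= fx _.
have := fx I => -[]; rewrite /sqc; case: (f x) => a b /= /eqP.
by rewrite paddr_eq0 ?sqr_ge0 // !sqrf_eq0 => /andP[/eqP -> /eqP ->].
Qed.

Lemma rip_ae f f' g : L2 f -> L2 f' -> L2 g -> f = f' %[ae muI R] ->
  rip g f = rip g f'.
Proof.
move=> Lf Lf' Lg ff'; rewrite /rip /Rintegral; congr fine.
have /L2P[mf _] := Lf; have /L2P[mf' _] := Lf'; have /L2P[mg _] := Lg.
apply: ae_eq_integral => //.
- by apply/measurable_EFinP; exact: measurable_rip.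
- by apply/measurable_EFinP; exact: measurable_rip.
- by move: ff'; apply: ae_muIS => x /= h _; rewrite h.
Qed.

(** The imaginary part of a number [z] is the real part of [- i z], and [- i] enters the conjugated
    first slot as [i]. *)
Lemma L2innerE f g : L2inner f g = rip f g +i* rip ((0 +i* 1) *: f) g.
Proof.
rewrite /L2inner /rip; congr (_ +i* _); apply: eq_Rintegral => x _.
  by case: (f x) (g x) => p q [a b] /=; ring.
rewrite (_ : ((0 +i* 1) *: f) x = (0 +i* 1) * f x) //.
by case: (f x) (g x) => p q [a b] /=; ring.
Qed.

(* The mass of [lebesgue_measure] is split between [itvI R] and its complement,
   on which [f \_ (itvI R)] vanishes. *)
Lemma ge0_integral_muI (f : R -> R) : measurable_fun setT f -> (forall x, 0 <= f x) ->
  (\int[muI R]_(x in setT) (f x)%:E =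
   \int[lebesgue_measure]_(x in itvI R) (f x)%:E)%E.
Proof.
move=> mf f0.
have mD := @measurable_itvI R.
have mDc : measurable (~` itvI R : set (measurableTypeR R)) by exact: measurableC.
pose g : measurableTypeR R -> \bar R := (fun x => (f x)%:E) \_ (itvI R).
have mg : measurable_fun setT g.
  apply/(measurable_restrictT _ _).1 => //.
  by apply/measurable_EFinP; exact: measurable_funTS.
have g0 x : (0 <= g x)%E by rewrite /g patchE; case: ifP => // _; rewrite lee_fin.
rewrite [RHS]integral_mkcond -/g.
rewrite (@eq_measure_integral _ _ _ _
  (measure_add (muI R) (mrestr (@lebesgue_measure R) mDc))) //; last first.
  move=> A mA _; rewrite /measure_add /= /msum 2!big_ord_recl big_ord0 /= adde0.
  rewrite /mrestr -measureU -?setIUr ?setUv ?setIT //; try exact: measurableI.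
  by rewrite setIACA setICr setI0.
rewrite ge0_integral_measure_add //.
rewrite [X in (_ = _ + X)%E](_ : _ = 0%E) ?adde0; last first.
  rewrite (@ge0_ae_eq_integral _ _ _ _ setT g (cst 0%E)) ?integral0 //.
  exists (itvI R); split => //.
    change (lebesgue_measure (itvI R `&` ~` itvI R) = 0)%E.
    by rewrite setICr measure0.
  move=> x /= /not_implyP[_]; rewrite /g patchE; case: ifPn => //.
  by rewrite inE.
apply: ge0_ae_eq_integral => //.
- by apply/measurable_EFinP.
- by move=> x _; rewrite lee_fin.
exists (~` itvI R); split => //.
  change (lebesgue_measure (~` itvI R `&` itvI R) = 0)%E.
  by rewrite setICl measure0.
move=> x /= /not_implyP[_]; rewrite /g patchE; case: ifPn => //.
by rewrite notin_setE.
Qed.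

End L2Space.

(** * Orthonormality of the eigenvectors *)

Lemma sin_intr_pi (R : realType) (m : int) : sin (m%:~R * pi) = 0 :> R.
Proof.
have sn (n : nat) : sin (n%:R * pi) = 0 :> R.
  rewrite mulr_natl -[X in sin X]add0r alternatingn ?sin0 ?mulr0 //.
  exact: sinDpi.
case: m => n; first exact: sn.
by rewrite NegzE mulrNz mulNr sinN sn oppr0.
Qed.

(** * Integrals of cosines over the interval *)

Section TrigonometricIntegrals.
Variable R : realType.

Definition ccont (f : R -> R[i]^o) : Prop :=
  continuous (fun x => complex.Re (f x)) /\ continuous (fun x => complex.Im (f x)).

Lemma ccont_meas f : ccont f -> cmeas f.
Proof. by move=> [c1 c2]; split; exact: continuous_measurable_fun. Qed.

Lemma continuous_affine (a b : R) : continuous (fun x => a * x + b).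
Proof.
move=> x; apply: cvgD; last exact: cvg_cst.
by apply: cvgM; [exact: cvg_cst|exact: cvg_id].
Qed.

Lemma continuous_cos_affine (a b : R) : continuous (fun x => cos (a * x + b)).
Proof.
move=> x; apply: (@continuous_comp _ _ _ (fun x => a * x + b) cos).
  exact: continuous_affine.
exact: continuous_cos.
Qed.

Lemma continuous_sin_affine (a b : R) : continuous (fun x => sin (a * x + b)).
Proof.
move=> x; apply: (@continuous_comp _ _ _ (fun x => a * x + b) sin).
  exact: continuous_affine.
exact: continuous_sin.
Qed.

Lemma is_derive_affine (a b x : R) : is_derive x 1 (fun x => a * x + b) a.
Proof.
have dM : is_derive x 1 (fun x : R => a * x) (a * 1) by exact: is_deriveZ.
have := is_deriveD dM (is_derive_cst b x 1).
by rewrite mulr1 addr0.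
Qed.

Lemma integral_muI_cst (k : R) : \int[muI R]_(x in setT) k = 2 * k.
Proof.
rewrite Rintegral_cst // mulrC; congr (_ * _).
rewrite /muI /= /mrestr setTI lebesgue_measure_itv /= lte_fin.
by rewrite ifT; [rewrite /= opprK|lra].
Qed.

Lemma muI_integrable (f : R -> R) (K : R) : continuous f -> (forall x, `|f x| <= K) ->
  (muI R).-integrable setT (EFin \o f).
Proof.
move=> cf fK; apply: measurable_bounded_integrable => //; first exact: muI_fin.
  exact: continuous_measurable_fun.
exists K; split; first by rewrite num_real.
by move=> M KM x _; apply: le_trans (fK x) _; exact: ltW.
Qed.

Lemma integrable_cos_affine (a b : R) :
  (muI R).-integrable setT (EFin \o (fun x => cos (a * x + b))).
Proof.
apply: (@muI_integrable _ 1); first exact: continuous_cos_affine.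
by move=> x; exact: cos_max.
Qed.

Lemma integral_cos_affine (a b : R) : a != 0 ->
  \int[muI R]_(x in setT) cos (a * x + b) = 2 * cos b * sin a / a.
Proof.
move=> a0.
(* The passage from [muI] to Lebesgue measure, [ge0_integral_muI], is stated for nonnegative
   functions; adding 1 makes the cosine nonnegative. *)
have c1 : continuous (fun x => 1 + cos (a * x + b)).
  by move=> x; apply: cvgD; [exact: cvg_cst|exact: continuous_cos_affine].
have i1 : \int[muI R]_(x in setT) (1 + cos (a * x + b)) =
    2 + \int[muI R]_(x in setT) cos (a * x + b).
  rewrite RintegralD ?integral_muI_cst ?mulr1 //; last exact: integrable_cos_affine.
  by apply: (@muI_integrable _ 1) => [x|x]; [exact: cvg_cst|rewrite normr1].
pose F x := x + a^-1 * sin (a * x + b).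
have dF (x : R) : is_derive x 1 F (1 + cos (a * x + b)).
  have dsin := @is_derive1_comp _ sin (fun x => a * x + b) x _ _
    (is_derive_sin (a * x + b)) (is_derive_affine a b x).
  have ds := is_deriveZ (a^-1 : R) dsin.
  have dFx := is_deriveD (is_derive_id x 1) ds.
  apply: (@is_derive_eq _ _ _ F _ _ _ _ dFx).
  by rewrite /GRing.scale /=; field.
have cF : continuous F.
  by move=> x; apply/differentiable_continuous/derivable1_diffP; case: (dF x).
have i2 : \int[muI R]_(x in setT) (1 + cos (a * x + b)) = F 1 - F (-1).
  rewrite /Rintegral ge0_integral_muI.
  - rewrite /itvI -(@integral_itv_bndoo _ _ _ _ true false); last first.
      apply/measurable_EFinP; apply: measurable_funTS.
      exact: continuous_measurable_fun.
    have N11 : (-1 : R) < 1 by lra.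
    rewrite (continuous_FTC2 (F := F) N11) //.
    + exact: continuous_subspaceT.
    + split.
      * by move=> x _; case: (dF x).
      * by apply: cvg_at_right_filter; exact: cF.
      * by apply: cvg_at_left_filter; exact: cF.
    + by move=> x _; rewrite derive1E derive_val.
  - exact: continuous_measurable_fun.
  - by move=> x; have := cos_geN1 (a * x + b); lra.
have -> : \int[muI R]_(x in setT) cos (a * x + b) = F 1 - F (-1) - 2.
  by rewrite -i2 i1; ring.
rewrite /F mulrN1 mulr1 [- a + b]addrC [a + b]addrC sinD sinB.
by field.
Qed.

Lemma integral_cos_pi (m : int) (b : R) : m != 0 ->
  \int[muI R]_(x in setT) cos (m%:~R * pi * x + b) = 0.
Proof.
move=> m0; rewrite integral_cos_affine.
  by rewrite sin_intr_pi mulr0 mul0r.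
by rewrite mulf_neq0 ?intr_eq0 // gt_eqF // pi_gt0.
Qed.

Lemma integral_cos_pihalf (m : int) : m != 0 ->
  \int[muI R]_(x in setT) cos (m%:~R * pi / 2 * (x + 1)) = 0.
Proof.
move=> m0; under eq_Rintegral do rewrite mulrDr mulr1.
rewrite integral_cos_affine; last first.
  by rewrite !mulf_neq0 ?intr_eq0 ?invr_eq0 ?pnatr_eq0 // gt_eqF // pi_gt0.
(* Here [a] and [b] both equal [m pi / 2], so the numerator is [2 cos a sin a = sin (2 a)]. *)
rewrite (_ : 2 * _ * _ = sin (m%:~R * pi)); first by rewrite sin_intr_pi mul0r.
rewrite [in RHS](_ : m%:~R * pi = (m%:~R * pi / 2) *+ 2); last by rewrite mulr2n; field.
by rewrite sin_mulr2n mulr2n; ring.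
Qed.

End TrigonometricIntegrals.

Section Eigenvectors.
Variable R : realType.
Local Notation ii := ((0 +i* 1) : R[i]).

Lemma eq_integral_muI (f g : R -> R) : f =1 g ->
  \int[muI R]_(x in setT) f x = \int[muI R]_(x in setT) g x.
Proof. by move=> fg; apply: eq_Rintegral => x _; exact: fg. Qed.

Lemma integrable_cos_shift (a : R) :
  (muI R).-integrable setT (EFin \o (fun x => cos (a * (x + 1)))).
Proof.
apply: (@muI_integrable _ _ 1) => [|x]; last exact: cos_max.
rewrite (_ : (fun x => _) = (fun x => cos (a * x + a))).
  exact: continuous_cos_affine.
by apply/funext => x; rewrite mulrDr mulr1.
Qed.

Lemma integral_cos_piE (m : int) (b : R) :
  \int[muI R]_(x in setT) cos (m%:~R * pi * x + b) = (m == 0)%:R * (2 * cos b).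
Proof.
have [->|m0] := eqVneq m 0; last by rewrite integral_cos_pi // mul0r.
by under eq_Rintegral do rewrite !mul0r add0r; rewrite integral_muI_cst mul1r.
Qed.

Lemma integral_cos_pihalfE (m : int) :
  \int[muI R]_(x in setT) cos (m%:~R * pi / 2 * (x + 1)) = (m == 0)%:R * 2.
Proof.
have [->|m0] := eqVneq m 0; last by rewrite integral_cos_pihalf // mul0r.
under eq_Rintegral do rewrite !mul0r cos0.
by rewrite integral_muI_cst mul1r mulr1.
Qed.

Lemma ccont_expi (q a : R) : ccont (fun x => q%:C * expi (a * x) : R[i]^o).
Proof.
split.
  rewrite (_ : (fun x => _) = (fun x => q * cos (a * x + 0))).
    by move=> x; apply: cvgM; [exact: cvg_cst|exact: continuous_cos_affine].
  by apply/funext => x /=; rewrite addr0; ring.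
rewrite (_ : (fun x => _) = (fun x => q * sin (a * x + 0))).
  by move=> x; apply: cvgM; [exact: cvg_cst|exact: continuous_sin_affine].
by apply/funext => x /=; rewrite addr0; ring.
Qed.

Lemma ccont_eigvec bc k : ccont (eigvec bc k : R -> R[i]^o).
Proof.
case: bc => /=; [exact: ccont_expi|exact: ccont_expi| |].
  rewrite /eigvec; case: (k == 0); first by split => x; exact: cvg_cst.
  split; last by move=> x; exact: cvg_cst.
  rewrite (_ : (fun x => _) = (fun x => cos (k%:~R * pi / 2 * x + k%:~R * pi / 2))).
    exact: continuous_cos_affine.
  by apply/funext => x /=; rewrite mulrDr mulr1.
split; last by move=> x; exact: cvg_cst.
rewrite (_ : (fun x => _) = (fun x => sin (k%:~R * pi / 2 * x + k%:~R * pi / 2))).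
  exact: continuous_sin_affine.
by apply/funext => x /=; rewrite mulrDr mulr1.
Qed.

Let isqrt2 : (Num.sqrt 2)^-1 * (Num.sqrt 2)^-1 = 2^-1 :> R.
Proof. by rewrite -invfM -[X in X^-1]expr2 sqr_sqrtr. Qed.

Lemma sqc_eigvec_le1 bc k x : sqc (eigvec bc k : R -> R[i]^o) x <= 1.
Proof.
have qe a : sqc (fun x => (Num.sqrt 2)^-1%:C * expi (a * x) : R[i]^o) x <= 1.
  rewrite /sqc /= !mul0r subr0 addr0 !exprMn -mulrDr cos2Dsin2 mulr1 expr2 isqrt2.
  by lra.
have sq (y : R) : `|y| <= 1 -> y ^+ 2 + 0 ^+ 2 <= 1.
  by move=> y1; rewrite expr0n addr0 -(real_normK (num_real y)) expr_le1.
case: bc; [exact: qe|exact: qe| |].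
  rewrite /sqc /eigvec; case: (k == 0) => /=.
    by rewrite expr0n addr0 expr2 isqrt2; lra.
  by apply: sq; exact: cos_max.
by rewrite /sqc /=; apply: sq; exact: sin_max.
Qed.

Lemma L2_eigvec bc k : L2 (eigvec bc k : R -> R[i]^o).
Proof.
apply: L2_bounded; first exact/ccont_meas/ccont_eigvec.
by exists 1 => x; exact: sqc_eigvec_le1.
Qed.

Lemma rip_expi (a b : R) (m : int) : a - b = m%:~R * pi ->
  rip (fun x => (Num.sqrt 2)^-1%:C * expi (a * x) : R[i]^o)
      (fun x => (Num.sqrt 2)^-1%:C * expi (b * x) : R[i]^o) = (m == 0)%:R.
Proof.
move=> abm; rewrite /rip.
rewrite (@eq_integral_muI _ (fun x => 2^-1 * cos (m%:~R * pi * x + 0))); last first.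
  move=> x /=; rewrite !mul0r !subr0 !addr0 -abm [(a - b) * x]mulrBl cosB -isqrt2.
  by ring.
rewrite RintegralZl //; last exact: integrable_cos_affine.
by rewrite integral_cos_piE cos0; field.
Qed.

Lemma rip_i_expi (a b : R) (m : int) : a - b = m%:~R * pi ->
  rip (ii *: ((fun x => (Num.sqrt 2)^-1%:C * expi (a * x)) : R -> R[i]^o))
      (fun x => (Num.sqrt 2)^-1%:C * expi (b * x) : R[i]^o) = 0.
Proof.
move=> abm; rewrite /rip.
(* The sine is written as a cosine with phase [pi / 2]: the same integral formula applies, and
   [cos (pi / 2) = 0] settles the case [m = 0]. *)
rewrite (@eq_integral_muI _ (fun x => 2^-1 * cos (m%:~R * pi * x + (pi / 2)))); last first.
  move=> x /=; rewrite cosDpihalf !mul0r !subr0 !addr0 -abm [(a - b) * x]mulrBl sinB -isqrt2.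
  by ring.
rewrite RintegralZl //; last exact: integrable_cos_affine.
by rewrite integral_cos_piE cos_pihalf !mulr0.
Qed.

Let intrB0 (k l : int) : (k - l == 0) = (k == l).
Proof. by rewrite subr_eq0. Qed.

Lemma rip_eigvec bc k l : eigen_index bc k -> eigen_index bc l ->
  rip (eigvec bc k : R -> R[i]^o) (eigvec bc l) = (k == l)%:R.
Proof.
case: bc => /=.
- by move=> _ _; rewrite (rip_expi (m := k - l)) ?intrB0 // intrB; ring.
- by move=> _ _; rewrite (rip_expi (m := k - l)) ?intrB0 // intrB; ring.
- move=> k0 l0; rewrite /rip /eigvec.
  have int0 (m : int) : m != 0 -> \int[muI R]_(x in setT)
      ((Num.sqrt 2)^-1 * cos (m%:~R * pi / 2 * (x + 1)) + 0 * 0) = 0.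
    move=> m0; under eq_Rintegral do rewrite mulr0 addr0 mulrDr mulr1.
    rewrite RintegralZl //; last exact: integrable_cos_affine.
    under eq_Rintegral do rewrite -[X in _ + X]mulr1 -mulrDr.
    by rewrite integral_cos_pihalf // mulr0.
  case: (eqVneq k 0) => [->|kn0]; case: (eqVneq l 0) => [l00|ln0] /=.
  + by rewrite integral_muI_cst mulr0 addr0 isqrt2; field.
  + by rewrite int0.
  + rewrite l00 (negbTE kn0) -[RHS](int0 k kn0).
    by apply: eq_Rintegral => x _; rewrite mulrC.
  (* After the product-to-sum formula only a zero frequency contributes. As [k] and [l] are
     nonnegative and [k] is nonzero, [k + l] is not zero, and [k - l] alone decides. *)
  have kl0 : (k + l == 0) = false.
    by apply/negP => /eqP kl; move/eqP: kn0; lia.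
  rewrite (@eq_integral_muI _ (fun x =>
     2^-1 * cos ((k - l)%:~R * pi / 2 * (x + 1)) +
     2^-1 * cos ((k + l)%:~R * pi / 2 * (x + 1)))); last first.
    move=> x; rewrite intrB intrD mulr0 addr0.
    set y := x + 1; set a := k%:~R; set b := l%:~R.
    rewrite (_ : (a - b) * pi / 2 * y = a * pi / 2 * y - b * pi / 2 * y); last by ring.
    rewrite (_ : (a + b) * pi / 2 * y = a * pi / 2 * y + b * pi / 2 * y); last by ring.
    by rewrite cosB cosD; field.
  have ic (m : int) : (muI R).-integrable setT
      (EFin \o (fun x => cos (m%:~R * pi / 2 * (x + 1)))).
    exact: integrable_cos_shift.
  have ich (m : int) : (muI R).-integrable setT
      (EFin \o (fun x => 2^-1 * cos (m%:~R * pi / 2 * (x + 1)))).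
    exact: (integrableZl _ 2^-1 (ic m)).
  rewrite RintegralD // !RintegralZl // !integral_cos_pihalfE kl0 intrB0.
  by rewrite mul0r mulr0 addr0; field.
- move=> k0 l0; rewrite /rip /eigvec /=.
  have kl0 : (k + l == 0) = false.
    by apply/negP => /eqP kl; lia.
  rewrite (@eq_integral_muI _ (fun x =>
     2^-1 * cos ((k - l)%:~R * pi / 2 * (x + 1)) -
     2^-1 * cos ((k + l)%:~R * pi / 2 * (x + 1)))); last first.
    move=> x; rewrite intrB intrD mulr0 addr0.
    set y := x + 1; set a := k%:~R; set b := l%:~R.
    rewrite (_ : (a - b) * pi / 2 * y = a * pi / 2 * y - b * pi / 2 * y); last by ring.
    rewrite (_ : (a + b) * pi / 2 * y = a * pi / 2 * y + b * pi / 2 * y); last by ring.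
    by rewrite cosB cosD; field.
  have ic (m : int) : (muI R).-integrable setT
      (EFin \o (fun x => cos (m%:~R * pi / 2 * (x + 1)))).
    exact: integrable_cos_shift.
  have ich (m : int) : (muI R).-integrable setT
      (EFin \o (fun x => 2^-1 * cos (m%:~R * pi / 2 * (x + 1)))).
    exact: (integrableZl _ 2^-1 (ic m)).
  rewrite RintegralB // !RintegralZl // !integral_cos_pihalfE kl0 intrB0.
  by rewrite mul0r mulr0 subr0; field.
Qed.

Lemma rip_i_eigvec bc k l :
  rip (ii *: (eigvec bc k : R -> R[i]^o)) (eigvec bc l) = 0.
Proof.
have real (f g : R -> R) : rip (ii *: ((fun x => (f x)%:C) : R -> R[i]^o))
    (fun x => (g x)%:C : R[i]^o) = 0.
  rewrite /rip -[RHS](mulr0 2) -(integral_muI_cst 0).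
  by apply: eq_Rintegral => x _ /=; ring.
case: bc.
- by rewrite (rip_i_expi (m := k - l)) // intrB; ring.
- by rewrite (rip_i_expi (m := k - l)) // intrB; ring.
- by rewrite /eigvec; case: (k == 0); case: (l == 0); exact: real.
- exact: real.
Qed.

(** The Boolean selects [i e_k] or [e_k]. Inadmissible indices are padded with the zero vector, so
    that one countable index type serves all four boundary conditions. *)
Definition eig bc (i : int * bool) : R -> R[i]^o :=
  if eigen_index bc i.1 then
    (if i.2 then ii *: (eigvec bc i.1 : R -> R[i]^o) else eigvec bc i.1)
  else 0.

Local Notation PH := (@rip_prehilbert R).

Lemma L2_eig bc i : L2 (eig bc i).
Proof.
rewrite /eig; case: ifP => _; last exact: L2_0.
by case: ifP => _; [apply: L2Z|]; exact: L2_eigvec.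
Qed.

Lemma rip_eig bc i j :
  rip (eig bc i) (eig bc j) = ((i == j) && eigen_index bc i.1)%:R.
Proof.
case: i j => k s [l r]; rewrite /eig /=.
case: ifP => Ik; last by rewrite andbF (phC PH) (phB0r PH) //; exact: (L2_eig bc (l, r)).
case Il: (eigen_index bc l); last first.
  rewrite (phB0r PH); last by case: s; [apply: L2Z|]; exact: L2_eigvec.
  by case: eqP => // -[kl _]; rewrite kl Il in Ik.
have Lk := L2_eigvec bc k; have Ll := L2_eigvec bc l.
rewrite xpair_eqE andbT; case: s r => -[] /=; rewrite ?andbT ?andbF.
- by rewrite (phBii PH) // rip_eigvec.
- by rewrite rip_i_eigvec.
- by rewrite (phC PH) rip_i_eigvec.
- by rewrite rip_eigvec.
Qed.

Lemma ccont_eig bc i : ccont (eig bc i).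
Proof.
rewrite /eig; case: ifP => _; last by split => x; exact: cvg_cst.
have [c1 c2] := ccont_eigvec bc i.1.
case: ifP => _ //; split.
  rewrite (_ : (fun x => _) = (fun x => - complex.Im (eigvec bc i.1 x))).
    by move=> x; apply: cvgN; exact: c2.
  apply/funext => x; rewrite (_ : (ii *: _) x = ii * eigvec bc i.1 x) //.
  by case: (eigvec _ _ _) => a b /=; ring.
rewrite (_ : (fun x => _) = (fun x => complex.Re (eigvec bc i.1 x))) //.
apply/funext => x; rewrite (_ : (ii *: _) x = ii * eigvec bc i.1 x) //.
by case: (eigvec _ _ _) => a b /=; ring.
Qed.

Lemma sqc_eig_le1 bc i x : sqc (eig bc i) x <= 1.
Proof.
rewrite /eig; case: ifP => _; last by rewrite /sqc /= expr0n addr0.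
case: ifP => _; last exact: sqc_eigvec_le1.
by rewrite sqcZ /= expr0n expr1n add0r mul1r; exact: sqc_eigvec_le1.
Qed.

End Eigenvectors.

(** * Absolutely convergent series of bounded functions *)

Section AbsoluteSeries.
Variables (R : realType) (a : nat -> R) (K : R).
Hypothesis aK : forall N, \sum_(n < N) `|a n| <= K.

Let cvg_a : cvgn (series (fun n => `|a n|)).
Proof.
apply: nondecreasing_is_cvgn.
  apply/nondecreasing_seqP => n; rewrite /series /= big_nat_recr //=.
  by rewrite lerDl.
by exists K => _ [N _ <-]; rewrite /series /= big_mkord.
Qed.

Let rem N := limn (series (fun n => `|a n|)) - \sum_(n < N) `|a n|.

Let rem_cvg : rem @ \oo --> 0.
Proof.
rewrite -[X in _ --> X](subrr (limn (series (fun n => `|a n|)))).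
apply: cvgB; first exact: cvg_cst.
rewrite [X in X @ _](_ : _ = series (fun n => `|a n|)) //.
by apply/funext => N; rewrite /series /= big_mkord.
Qed.

(** This is the Weierstrass M-test: the tail of [\sum |a n|] is a uniform error bound. The rate [r]
    is returned because it also yields convergence in mean square. *)
Lemma absolute_series_continuous (g : nat -> R -> R) :
  (forall n, continuous (g n)) -> (forall n x, `|g n x| <= 1) ->
  exists2 S : R -> R, continuous S &
    exists2 r : nat -> R, r @ \oo --> 0 &
      forall N x, `|S x - \sum_(n < N) a n * g n x| <= r N.
Proof.
move=> cg g1.
have cS x : cvgn (series (fun n => a n * g n x)).
  apply: normed_cvg; apply: series_le_cvg cvg_a => n //=.
  by rewrite normrM ler_piMr.
pose S x := limn (series (fun n => a n * g n x)).
have Sr N x : `|S x - \sum_(n < N) a n * g n x| <= rem N.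
  have lS : series (fun n => a n * g n x) M - \sum_(n < N) a n * g n x @[M --> \oo]
      --> S x - \sum_(n < N) a n * g n x.
    by apply: cvgB; [exact: cS|exact: cvg_cst].
  have lA : series (fun n => `|a n|) M - \sum_(n < N) `|a n| @[M --> \oo] --> rem N.
    by apply: cvgB; [exact: cvg_a|exact: cvg_cst].
  have lN : `|series (fun n => a n * g n x) M - \sum_(n < N) a n * g n x| @[M --> \oo]
      --> `|S x - \sum_(n < N) a n * g n x| by apply: cvg_norm; exact: lS.
  rewrite -(cvg_lim _ lN) // -(cvg_lim _ lA) //.
  apply: ler_lim; [exact: cvgP lN|exact: cvgP lA|].
  exists N => // M /= NM; rewrite /series /= -(big_mkord xpredT (fun n => a n * g n x)).
  rewrite -(big_mkord xpredT (fun n => `|a n|)).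
  rewrite !(@big_cat_nat _ _ _ N 0 M) //= [X in `|X|]addrAC subrr add0r.
  rewrite [leRHS]addrAC subrr add0r.
  apply: le_trans (ler_norm_sum _ _ _) _; apply: ler_sum => i _.
  by rewrite normrM ler_piMr.
exists S; last by exists rem.
have cP N : continuous (fun x => \sum_(n < N) a n * g n x).
  elim: N => [|N ih].
    rewrite (_ : (fun x => _) = cst 0); first by move=> x; exact: cvg_cst.
    by apply/funext => x; rewrite big_ord0.
  rewrite (_ : (fun x => _) = (fun x => \sum_(n < N) a n * g n x + a N * g N x)).
    move=> x; apply: cvgD; first exact: ih.
    by apply: cvgM; [exact: cvg_cst|exact: cg].
  by apply/funext => x; rewrite big_ord_recr.
move=> x; apply/cvgrPdist_le => e e0.
have e3 : 0 < e / 3 by rewrite divr_gt0.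
have /cvgrPdist_le/(_ _ e3)[N _ /(_ N (leqnn N))] := rem_cvg.
rewrite sub0r normrN => rN.
have rN' y : `|S y - \sum_(n < N) a n * g n y| <= e / 3.
  by apply: le_trans (Sr N y) _; apply: le_trans rN; exact: ler_norm.
have /cvgrPdist_le/(_ _ e3) := cP N x.
apply: filterS => y xy.
have -> : S x - S y = (S x - \sum_(n < N) a n * g n x)
  - (S y - \sum_(n < N) a n * g n y) +
  (\sum_(n < N) a n * g n x - \sum_(n < N) a n * g n y) by ring.
apply: le_trans (ler_normD _ _) _.
apply: (@le_trans _ _ (e / 3 + e / 3 + e / 3)); last by lra.
apply: lerD => //; apply: le_trans (ler_normB _ _) _.
by apply: lerD.
Qed.

(** Uniform convergence on an interval of finite length implies convergence for [rip], and
    Cauchy-Schwarz carries it over to pairings with [z]. In the applications the partial sums of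
    these pairings are eventually constant, so the conclusion names their final value [l] instead of
    a limit. *)
Lemma absolute_series_L2 (e : nat -> R -> R[i]^o) :
  (forall n, ccont (e n)) -> (forall n x, sqc (e n) x <= 1) ->
  exists S : R -> R[i]^o, [/\ ccont S, L2 S &
    forall (z : R -> R[i]^o) (l : R) (N0 : nat), L2 z ->
      (forall N, (N0 <= N)%N -> \sum_(n < N) a n * rip z (e n) = l) ->
      rip z S = l].
Proof.
move=> ce e1.
have Le n : L2 (e n).
  by apply: L2_bounded; [exact: ccont_meas|exists 1].
have c1 n : continuous (fun x => complex.Re (e n x)) by case: (ce n).
have c2 n : continuous (fun x => complex.Im (e n x)) by case: (ce n).
have b1 n x : `|complex.Re (e n x)| <= 1.
  rewrite -(@expr_le1 _ 2) // real_normK ?num_real //.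
  by apply: le_trans (e1 n x); rewrite lerDl sqr_ge0.
have b2 n x : `|complex.Im (e n x)| <= 1.
  rewrite -(@expr_le1 _ 2) // real_normK ?num_real //.
  by apply: le_trans (e1 n x); rewrite lerDr sqr_ge0.
have [S1 cS1 [r1 r10 hr1]] := absolute_series_continuous c1 b1.
have [S2 cS2 [r2 r20 hr2]] := absolute_series_continuous c2 b2.
pose S : R -> R[i]^o := fun x => S1 x +i* S2 x.
have cS : ccont S by [].
have sqr_le (y r : R) : `|y| <= r -> y ^+ 2 <= r ^+ 2.
  move=> yr; rewrite -(real_normK (num_real y)).
  by apply: lerXn2r => //; rewrite nnegrE // (le_trans _ yr).
have ReS N x : complex.Re ((\sum_(n < N) (a n)%:C *: e n) x) =
    \sum_(n < N) a n * complex.Re (e n x).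
  elim: N => [|N ih]; first by rewrite !big_ord0.
  rewrite !big_ord_recr /= -ih raddfD /=; congr (_ + _).
  by rewrite (_ : ((a N)%:C *: e N) x = (a N)%:C * e N x) //;
    case: (e N x) => p q /=; ring.
have ImS N x : complex.Im ((\sum_(n < N) (a n)%:C *: e n) x) =
    \sum_(n < N) a n * complex.Im (e n x).
  elim: N => [|N ih]; first by rewrite !big_ord0.
  rewrite !big_ord_recr /= -ih raddfD /=; congr (_ + _).
  by rewrite (_ : ((a N)%:C *: e N) x = (a N)%:C * e N x) //;
    case: (e N x) => p q /=; ring.
have sqd N x : sqc (S - \sum_(n < N) (a n)%:C *: e n) x <= r1 N ^+ 2 + r2 N ^+ 2.
  rewrite /sqc [(S - _) x](_ : _ = S x - (\sum_(n < N) (a n)%:C *: e n) x) //.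
  rewrite !raddfB /= ReS ImS; apply: lerD; apply: sqr_le; [exact: hr1|exact: hr2].
have LS : L2 S.
  apply: L2_bounded; first exact: ccont_meas.
  exists (r1 0%N ^+ 2 + r2 0%N ^+ 2) => x.
  by have := sqd 0%N x; rewrite big_ord0 subr0.
have PH := @rip_prehilbert R.
exists S; split=> // z l N0 Lz hl.
have Lae n : L2 ((a n)%:C *: e n : R -> R[i]^o) by exact: L2Z.
have LP N : L2 (\sum_(n < N) (a n)%:C *: e n : R -> R[i]^o) by exact: (ph_sum PH).
have Ld N : L2 (S - \sum_(n < N) (a n)%:C *: e n : R -> R[i]^o) by exact: (phB PH).
(* The factor 2 is the length of the interval. *)
have phd N : rip (S - \sum_(n < N) (a n)%:C *: e n) (S - \sum_(n < N) (a n)%:C *: e n)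
    <= 2 * (r1 N ^+ 2 + r2 N ^+ 2).
  rewrite -integral_muI_cst; apply: le_Rintegral => //.
  - exact: rip_integrable.
  - apply: (@muI_integrable _ _ `|r1 N ^+ 2 + r2 N ^+ 2|) => // x.
    exact: cvg_cst.
  - by move=> x _; have := sqd N x; rewrite /sqc -!expr2.
have key N : (N0 <= N)%N ->
    (rip z S - l) ^+ 2 <= rip z z * (2 * (r1 N ^+ 2 + r2 N ^+ 2)).
  move=> NN; rewrite -(hl N NN).
  have -> : \sum_(n < N) a n * rip z (e n) = rip z (\sum_(n < N) (a n)%:C *: e n).
    by rewrite (phB_sumr PH) //; apply: eq_bigr => i _; rewrite (phBZr PH).
  rewrite -(phBBr PH) // -(real_normK (num_real (rip z _))).
  apply: (@le_trans _ _
    ((phn (@rip R) z * phn (@rip R) (S - \sum_(n < N) (a n)%:C *: e n)) ^+ 2)).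
    by apply: lerXn2r; rewrite ?nnegrE ?mulr_ge0 ?phn_ge0 // (ph_CS PH).
  rewrite exprMn !(phn_sqr PH) //; apply: ler_wpM2l; first exact: (ph_ge0 PH).
  exact: phd.
have lim0 : rip z z * (2 * (r1 N * r1 N + r2 N * r2 N)) @[N --> \oo] -->
    (rip z z * (2 * (0 * 0 + 0 * 0)) : R).
  apply: cvgM; first exact: cvg_cst.
  apply: cvgM; first exact: cvg_cst.
  by apply: cvgD; apply: cvgM.
rewrite !mul0r addr0 !mulr0 in lim0.
have : (rip z S - l) ^+ 2 <= 0.
  rewrite -(cvg_lim _ lim0) //; apply: limr_ge; first exact: cvgP lim0.
  by exists N0 => // N /= /key; rewrite !expr2.
move=> h0; apply/eqP; rewrite -subr_eq0 -sqrf_eq0.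
by apply/eqP/le_anti; rewrite h0 sqr_ge0.
Qed.

End AbsoluteSeries.

Lemma ccont_continuous (R : realType) (S : R -> R[i]^o) : ccont S -> continuous S.
Proof.
move=> [c1 c2].
pose F : R -> R[i]^o := fun x => ((complex.Re (S x))%:C : R[i]^o) +
    (0 +i* 1 : R[i]) *: ((complex.Im (S x))%:C : R[i]^o).
have -> : S = F.
  apply/funext => x; rewrite /F /GRing.scale /=; case: (S x) => p q.
  by apply/eqP; rewrite eq_complex /=; apply/andP; split; apply/eqP; ring.
move=> x; apply: cvgD; first by apply: cvg_real_complex; exact: c1.
by apply: cvgZl_tmp; apply: cvg_real_complex; exact: c2.
Qed.

(** * The operator h(A) *)

Section FunOp.
Variables (R : realType) (bc : boundary_condition) (h : R -> R).
Local Notation ii := ((0 +i* 1) : R[i]).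
Local Notation PH := (@rip_prehilbert R).

Definition eig_term (w : R -> R[i]^o) (k : int) : R -> R[i]^o :=
  ((h (eigval R bc k))%:C * L2inner (eigvec bc k) w) *: (eigvec bc k : R -> R[i]^o).

Lemma L2_eig_term w k : L2 (eig_term w k).
Proof. by apply: L2Z; exact: L2_eigvec. Qed.

Lemma rip_eig_term (z w : R -> R[i]^o) k : eigen_index bc k -> L2 z -> L2 w ->
  rip z (eig_term w k) = h (eigval R bc k) *
    (rip (eig bc (k, false)) w * rip z (eig bc (k, false)) +
     rip (eig bc (k, true)) w * rip z (eig bc (k, true))).
Proof.
move=> Ik Lz Lw; rewrite /eig /= Ik.
have Lk := L2_eigvec R bc k; have Lik := L2Z ii Lk.
rewrite (_ : eig_term w k = (h (eigval R bc k))%:C *: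
    ((rip (eigvec bc k) w)%:C *: (eigvec bc k : R -> R[i]^o) +
     (rip (ii *: (eigvec bc k : R -> R[i]^o)) w)%:C *:
       (ii *: (eigvec bc k : R -> R[i]^o)))); last first.
  rewrite /eig_term L2innerE scalerA -scalerDl scalerA; congr (_ * _ *: _).
  by apply/eqP; rewrite eq_complex /=; apply/andP; split; apply/eqP; ring.
have L1 := L2Z (rip (eigvec bc k) w)%:C Lk.
have L2' := L2Z (rip (ii *: (eigvec bc k : R -> R[i]^o)) w)%:C Lik.
have L3 := L2D L1 L2'.
by rewrite (phBZr PH) // (phBDr PH) // !(phBZr PH).
Qed.

(** The remainder tends to 0 in norm along the finite sets, so by Cauchy-Schwarz the pairing with
    [z] is the limit of its pairings with the partial sums. In both applications these are constant
    once [F] contains [F1]. *)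
Lemma fun_op_weak (z w v : R -> R[i]^o) (F1 : {fset int}) (l : R) :
  fun_op bc h w v -> L2 z ->
  (forall F : {fset int}, (F1 `<=` F)%fset ->
     \sum_(k <- F | eigen_index bc k) rip z (eig_term w k) = l) ->
  rip z v = l.
Proof.
move=> [Lw Lv wv] Lz hF; have FT := @totally_filter int.
pose S (F : {fset int}) : R -> R[i]^o :=
  \sum_(k <- F | eigen_index bc k) eig_term w k.
have LS F : L2 (S F) by apply: (ph_sum PH) => k; exact: L2_eig_term.
have phS : phn (@rip R) (v - S F) @[F --> totally] --> 0.
  have lE : (phn (@rip R) (v - S F))%:E @[F --> totally] --> 0%:E.
    apply: cvg_trans wv; rewrite [X in _ `=>` fmap X _](_ : _ =
      (fun F => (phn (@rip R) (v - S F))%:E)) //; apply/funext => F; symmetry.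
    rewrite -L2norm_phn; last exact: (phB PH).
    congr L2norm; apply/funext => x.
    by rewrite (_ : (v - S F) x = v x - S F x) // /S fct_sumE.
  by apply: (fine_cvg lE); exact: totally_filter.
apply/eqP; rewrite -subr_eq0 -normr_eq0; apply/eqP/le_anti; rewrite normr_ge0 andbT.
have lim0 : phn (@rip R) z * phn (@rip R) (v - S F) @[F --> totally] -->
    (phn (@rip R) z * 0 : R).
  by apply: cvgM => //; exact: cvg_cst.
rewrite mulr0 in lim0.
rewrite -(cvg_lim _ lim0) //; apply: limr_ge; first exact: cvgP lim0.
exists F1 => // F /= F1F; rewrite -(hF F F1F).
have <- : rip z (S F) = \sum_(k <- F | eigen_index bc k) rip z (eig_term w k).
  by rewrite (phB_sumr PH) // => k; exact: L2_eig_term.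
by rewrite -(phBBr PH) //; apply: (ph_CS PH) => //; exact: (phB PH).
Qed.

(** The range of [h(A)] lies in the closed span of the [e_k]; this is what stands in for
    completeness at the end of the proof. *)
Lemma fun_op_orth (z w v : R -> R[i]^o) : fun_op bc h w v -> L2 z ->
  (forall i, rip z (eig bc i) = 0) -> rip z v = 0.
Proof.
move=> wv Lz z0; apply: (fun_op_weak (F1 := fset0) wv Lz) => F _.
have Lw : L2 w by case: wv.
by apply: big1 => k Ik; rewrite rip_eig_term // !z0 !mulr0 addr0 mulr0.
Qed.

Definition eig_mult (i : int * bool) : R :=
  if eigen_index bc i.1 then h (eigval R bc i.1) else 0.

Lemma fun_op_eig (w v : R -> R[i]^o) i : fun_op bc h w v ->
  rip (eig bc i) v = eig_mult i * rip (eig bc i) w.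
Proof.
move=> wv; have Lw : L2 w by case: wv.
have Lv : L2 v by case: wv.
rewrite /eig_mult; case Ii: (eigen_index bc i.1); last first.
  by rewrite /eig Ii mul0r (phC PH) (phB0r PH).
(* Once [F] contains [i.1], orthonormality removes all other terms, and of the two real components
   of the remaining one only that of [i] survives. *)
apply: (fun_op_weak (F1 := [fset i.1]%fset) wv); first exact: L2_eig.
move=> F; rewrite fsub1set => iF.
rewrite big_mkcond (bigD1_seq i.1) ?fset_uniq //= big1 ?addr0; last first.
  move=> k ki; case Ik: (eigen_index bc k) => //.
  rewrite rip_eig_term //; last exact: L2_eig.
  have ne s : (i == (k, s)) = false.
    by apply/eqP => E; move: ki; rewrite E eqxx.
  by rewrite !rip_eig !ne !mulr0 addr0 mulr0.
rewrite Ii rip_eig_term //; last exact: L2_eig.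
rewrite !rip_eig Ii !andbT; case: i iF Ii => k [] _ _; rewrite !xpair_eqE !eqxx /=;
by ring.
Qed.

(** The family is enumerated by the natural numbers through the countable encoding of [int * bool];
    numbers that encode no index receive the zero vector. *)
Definition eigseq (n : nat) : R -> R[i]^o :=
  if pickle_inv n is Some i then eig bc i else 0.

Definition multseq (n : nat) : R :=
  if pickle_inv n is Some i then eig_mult i else 0.

Lemma eigseq_pickle (i : int * bool) : eigseq (choice.pickle i) = eig bc i.
Proof. by rewrite /eigseq pickleK_inv. Qed.

Lemma L2_eigseq n : L2 (eigseq n).
Proof. by rewrite /eigseq; case: pickle_inv => [i|]; [exact: L2_eig|exact: L2_0]. Qed.

Lemma ph_orth_eigseq : ph_orth (@L2 R) (@rip R) eigseq.
Proof.
split; first exact: L2_eigseq.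
- move=> m n mn; have Lm := L2_eigseq m; have Ln := L2_eigseq n.
  move: Lm Ln; rewrite /eigseq.
  case Em : (pickle_inv m) => [i|]; last by move=> _ Ln; rewrite (phC PH) (phB0r PH).
  case En : (pickle_inv n) => [j|]; last by move=> Lm _; rewrite (phB0r PH).
  rewrite rip_eig; case: eqP => // ij _ _; move: mn.
  have := @pickle_invK (int * bool)%type m; have := @pickle_invK (int * bool)%type n.
  by rewrite Em En /= ij => -> ->; rewrite eqxx.
- move=> n; rewrite /eigseq; case: pickle_inv => [i|].
    by rewrite rip_eig eqxx; case: eigen_index.
  by rewrite (phB0r PH) ?ler01 //; exact: L2_0.
Qed.

Lemma multseq_norm n : multseq n = 0 \/ rip (eigseq n) (eigseq n) = 1.
Proof.
rewrite /multseq /eigseq /eig_mult; case: pickle_inv => [i|]; last by left.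
case Ii: eigen_index; last by left.
by right; rewrite rip_eig eqxx Ii.
Qed.

Lemma eigseq_norm n : eigseq n = 0 \/ rip (eigseq n) (eigseq n) = 1.
Proof.
rewrite /eigseq; case: pickle_inv => [i|]; last by left.
case Ii: (eigen_index bc i.1); last by left; rewrite /eig Ii.
by right; rewrite rip_eig eqxx Ii.
Qed.

Lemma fun_op_eigseq (w v : R -> R[i]^o) n : fun_op bc h w v ->
  rip (eigseq n) v = multseq n * rip (eigseq n) w.
Proof.
move=> wv; have [Lw Lv _] := wv.
rewrite /eigseq /multseq; case: pickle_inv => [i|]; first exact: fun_op_eig.
by rewrite mul0r (phC PH) (phB0r PH).
Qed.

(* Multiplication by the imaginary unit permutes the [eig bc i] up to sign. *)
Lemma fun_op_i_eigseq (w v : R -> R[i]^o) n : fun_op bc h w v ->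
  rip (eigseq n) (ii *: v) = multseq n * rip (eigseq n) (ii *: w).
Proof.
move=> wv; have [Lw Lv _] := wv.
have Liw := L2Z ii Lw; have Liv := L2Z ii Lv.
rewrite /eigseq /multseq; case: pickle_inv => [[k s]|]; last first.
  by rewrite mul0r (phC PH) (phB0r PH).
rewrite /eig_mult /=; case Ik: (eigen_index bc k); last first.
  by rewrite /eig Ik mul0r (phC PH) (phB0r PH).
have Lk := L2_eigvec R bc k.
have eF := fun_op_eig (k, false) wv; have eT := fun_op_eig (k, true) wv.
rewrite /eig /eig_mult /= Ik in eF eT.
case: s; rewrite /eig /= Ik.
  by rewrite !(phBii PH).
have iE (g : R -> R[i]^o) : L2 g -> rip (eigvec bc k : R -> R[i]^o) (ii *: g) =
    - rip (ii *: (eigvec bc k : R -> R[i]^o)) g.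
  by move=> Lg; rewrite (phBi PH) // opprK.
by rewrite !iE // eT mulrN.
Qed.

End FunOp.

(** * Square summability of the eigenvalues of a Hilbert-Schmidt h(A) *)

Section HilbertSchmidtBound.
Variables (R : realType) (bc : boundary_condition) (h : R -> R).
Local Notation ii := ((0 +i* 1) : R[i]).
Local Notation PH := (@rip_prehilbert R).

(** The sequence [b 0, i b 0, b 1, i b 1, ...] turns a complex orthonormal family into a real one; a
    complex coefficient splits into its real and imaginary parts. *)
Definition interleave (b : nat -> R -> R[i]^o) (n : nat) : R -> R[i]^o :=
  if odd n then ii *: b n./2 else b n./2.

Lemma interleave_sum (b : nat -> R -> R[i]^o) (f : nat -> R[i]) m :
  \sum_(j < m) f j *: b j =
  \sum_(j <- iota 0 m.*2)
    (if odd j then complex.Im (f j./2) else complex.Re (f j./2))%:C *: interleave b j.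
Proof.
elim: m => [|m ih]; first by rewrite big_ord0 big_nil.
rewrite big_ord_recr doubleS -addn2 iotaD big_cat /= ih add0n.
rewrite !big_cons big_nil addr0 /interleave /= odd_double /= doubleK uphalf_double.
congr (_ + _); rewrite scalerA -scalerDl; congr (_ *: _).
by case: (f m) => p q; apply/eqP; rewrite eq_complex /=; apply/andP; split; apply/eqP; ring.
Qed.

Lemma L2_interleave b : (forall j, L2 (b j : R -> R[i]^o)) -> forall n, L2 (interleave b n).
Proof. by move=> Lb n; rewrite /interleave; case: odd => //; exact: L2Z. Qed.

Lemma hilbert_schmidt_multseq : hilbert_schmidt (fun_op bc h) ->
  exists H : R, forall N, \sum_(n < N) multseq bc h n ^+ 2 <= H.
Proof.
move=> [b [Tb [[Lb ob tot] bTb HS]]].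
have LT j : L2 (Tb j) by case: (bTb j).
have LIb := L2_interleave Lb; have LIT := L2_interleave LT.
have rb j k : rip (b j) (b k) = (j == k)%:R.
  by have := congr1 (@complex.Re R) (ob j k); rewrite L2innerE /= => ->; case: (j == k).
have rib j k : rip (ii *: (b j : R -> R[i]^o)) (b k) = 0.
  by have := congr1 (@complex.Im R) (ob j k); rewrite L2innerE /= => ->; case: (j == k).
have b1 j : rip (interleave b j) (interleave b j) = 1.
  by rewrite /interleave; case: odd; rewrite ?(phBii PH) // rb eqxx.
have obb : ph_orth (@L2 R) (@rip R) (interleave b).
  split=> //; last by move=> j; rewrite b1.
  move=> m n mn; rewrite /interleave.
  case Om : (odd m); case On : (odd n).
  - rewrite (phBii PH) // rb; case: eqP => // mn2; move: mn.
    by rewrite -(odd_double_half m) -(odd_double_half n) Om On mn2 eqxx.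
  - by rewrite rib.
  - by rewrite (phC PH) rib.
  - rewrite rb; case: eqP => // mn2; move: mn.
    by rewrite -(odd_double_half m) -(odd_double_half n) Om On mn2 eqxx.
pose H0 := fine (\sum_(0 <= j <oo) (L2norm (Tb j) * L2norm (Tb j)))%E.
have TE j : (L2norm (Tb j) * L2norm (Tb j) = (rip (Tb j) (Tb j))%:E)%E.
  by rewrite (L2norm_phn (LT j)) -EFinM -expr2 (phn_sqr PH).
have pos j : (0 <= L2norm (Tb j) * L2norm (Tb j))%E.
  by rewrite TE lee_fin (ph_ge0 PH).
have H0le m : \sum_(0 <= j < m) rip (Tb j) (Tb j) <= H0.
  rewrite -lee_fin /H0 fineK; last by rewrite ge0_fin_numE // nneseries_ge0.
  rewrite -sumEFin; under eq_bigr do rewrite -TE.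
  exact: nneseries_lim_ge.
have tbH m : \sum_(j <- iota 0 m) rip (interleave Tb j) (interleave Tb j) <= 2 * H0.
  have rI j : rip (interleave Tb j) (interleave Tb j) = rip (Tb j./2) (Tb j./2).
    by rewrite /interleave; case: odd => //; rewrite (phBii PH).
  have dbl p : \sum_(j <- iota 0 p.*2) rip (interleave Tb j) (interleave Tb j) =
      2 * \sum_(0 <= j < p) rip (Tb j) (Tb j).
    elim: p => [|p ih]; first by rewrite big_nil big_geq // mulr0.
    rewrite doubleS -addn2 iotaD big_cat /= ih add0n big_nat_recr //= !big_cons big_nil.
    by rewrite !rI /= doubleK uphalf_double; ring.
  (* The sum is enlarged from [m] to [m.*2] terms, where the pairs are complete. *)
  apply: (@le_trans _ _ (2 * \sum_(0 <= j < m) rip (Tb j) (Tb j))); last first.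
    by apply: ler_wpM2l => //; exact: H0le.
  rewrite -dbl -addnn iotaD big_cat /= lerDl.
  by apply: sumr_ge0 => j _; rewrite (ph_ge0 PH).
(* [H0] is the squared Hilbert-Schmidt norm; one factor 2 comes from interleaving, the other from
   [hilbert_schmidt_sum]. *)
exists (2 * (2 * H0)) => N.
have := @hilbert_schmidt_sum R _ _ _ PH (eigseq bc) (interleave b) (interleave Tb)
  (multseq bc h) (2 * H0) (ph_orth_eigseq R bc) obb b1 LIT (multseq_norm bc h).
rewrite -(big_mkord xpredT (fun n => multseq bc h n ^+ 2)) /index_iota subn0; apply => //.
(* The density of the span is used at distance 1/2, which keeps the squared distance below 1/2. *)
- move=> n; have /tot/(_ 2^-1) := L2_eigseq R bc n.
  rewrite invr_gt0 ltr0n => /(_ isT)[m [a ha]].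
  pose f j : R[i] := if insub j is Some i then a i else 0.
  exists m.*2, (fun j => if odd j then complex.Im (f j./2) else complex.Re (f j./2)).
  rewrite -interleave_sum.
  have Lf j : L2 (f j *: (b j : R -> R[i]^o)) by exact: L2Z.
  have Ld : L2 (eigseq bc n - \sum_(j < m) f j *: (b j : R -> R[i]^o)).
    by apply: (phB PH); [exact: L2_eigseq|exact: (ph_sum PH)].
  move: ha; rewrite (_ : (fun x => _) =
    (eigseq bc n - \sum_(j < m) f j *: (b j : R -> R[i]^o))); last first.
    apply/funext => x; rewrite (_ : (eigseq bc n - _) x =
      eigseq bc n x - (\sum_(j < m) f j *: (b j : R -> R[i]^o)) x) //.
    rewrite fct_sumE; congr (_ - _); apply: eq_bigr => j _.
    by rewrite /f insubT ?ltn_ord //= => jm; congr (a _ * _); apply: val_inj.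
  rewrite (L2norm_phn Ld) lte_fin => ph2.
  rewrite -(phn_sqr PH) //.
  have := phn_ge0 (@rip R) (eigseq bc n - \sum_(j < m) f j *: (b j : R -> R[i]^o)).
  by move: ph2; set p := phn _ _ => p2 p0; rewrite expr2; nra.
- move=> j n; rewrite /interleave; case: odd.
    exact: fun_op_i_eigseq.
  exact: fun_op_eigseq.
Qed.

End HilbertSchmidtBound.

(** * The solution formula modulo a continuous function *)

Lemma ae_muIS3 (R : realType) (P Q S W : R -> Prop) :
  (forall x, P x -> Q x -> S x -> W x) ->
  {ae muI R, forall x, P x} -> {ae muI R, forall x, Q x} ->
  {ae muI R, forall x, S x} -> {ae muI R, forall x, W x}.
Proof.
by move=> PQ; exact: (@filterS3 _ _ (ae_filter_ringOfSetsType (muI R)) _ _ _ _ PQ).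
Qed.

Lemma ccont_eigseq (R : realType) bc n : ccont (@eigseq R bc n).
Proof.
rewrite /eigseq; case: pickle_inv => [i|]; first exact: ccont_eig.
by split => x; exact: cvg_cst.
Qed.

Lemma sqc_eigseq_le1 (R : realType) bc n (x : R) : sqc (eigseq bc n) x <= 1.
Proof.
rewrite /eigseq; case: pickle_inv => [i|]; first exact: sqc_eig_le1.
by rewrite /sqc /= expr0n addr0 ler01.
Qed.

Lemma L2_derivative_ph (R : realType) (u v : R -> R -> R[i]^o) :
  (forall t, L2 (u t)) -> (forall t, L2 (v t)) -> L2_derivative u v ->
  ph_deriv (V := R -> R[i]^o) (@rip R) u v.
Proof.
move=> Lu Lv uv t; have PH := @rip_prehilbert R.
have LE : (phn (@rip R) (ph_quot (V := R -> R[i]^o) u v t s))%:E @[s --> 0^'] --> 0%:E.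
  apply: cvg_trans (uv t); apply: near_eq_cvg; apply: nearW => s.
  rewrite -L2norm_phn //; apply: (phB PH) => //; apply: (phZ PH).
  exact: (phB PH).
exact: (fine_cvg LE).
Qed.

Lemma wave_solution_eq (R : realType) (bc : boundary_condition) (c : R)
    (h : R -> R) (u0 v0 : R -> R[i]^o) (u : R -> R -> R[i]^o) (T : R) :
  hilbert_schmidt (fun_op bc h) -> L2 u0 -> L2 v0 ->
  wave_solution bc h c u0 v0 u ->
  exists2 S : R -> R[i]^o, continuous S &
    u T = (fun x => cos_sqrt T c%:C * u0 x + sin_sqrt T c%:C * v0 x + S x)
      %[ae muI R].
Proof.
move=> hHS Lu0 Lv0 [u1 [u2 [Lu [du du1 _] eqn ui vi]]].
have PH := @rip_prehilbert R.
have [H hH] := hilbert_schmidt_multseq hHS.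
have Luu t : L2 (u t) by case: (Lu t).
have Lu1 t : L2 (u1 t) by case: (Lu t).
have Lu2 t : L2 (u2 t) by case: (Lu t).
have /choice[hu huP] : forall t, exists hut : R -> R[i]^o, fun_op bc h (u t) hut /\
    (fun x => u2 t x + (c%:C * u t x - hut x)) = cst 0 %[ae muI R].
  by move=> t; have [hut h1 h2] := eqn t; exists hut.
have Lhu t : L2 (hu t) by have [[]] := huP t.
(* The equation holds only almost everywhere; paired with [z] it becomes an identity of numbers,
   since [rip] ignores null sets. *)
have weq (z : R -> R[i]^o) t : L2 z ->
    rip z (u2 t) = - c * rip z (u t) + rip z (hu t).
  move=> Lz; have [_ ae0] := huP t.
  have Lcu : L2 (c%:C *: (u t : R -> R[i]^o)) by exact: L2Z.
  have Lcuh : L2 (c%:C *: (u t : R -> R[i]^o) - hu t) by exact: (phB PH).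
  have L0 : L2 (cst 0 : R -> R[i]^o) by exact: L2_0.
  have := @rip_ae _ (u2 t + (c%:C *: (u t : R -> R[i]^o) - hu t)) (cst 0) z
    (L2D (Lu2 t) Lcuh) L0 Lz ae0.
  rewrite (phB0r PH) // (phBDr PH) // (phBBr PH) // (phBZr PH) //.
  by lra.
have [K K0 hK] := @duhamel_bound R _ _ _ PH c (wave_cos c) (wave_sin c)
  (@is_derive_wave_cos R c) (@is_derive_wave_sin R c) (wave_cos0 c) (wave_sin0 c)
  u u1 u2 hu Luu Lu1 Lu2 (L2_derivative_ph Luu Lu1 du)
  (L2_derivative_ph Lu1 Lu2 du1) weq T.
pose w : R -> R[i]^o := (u T : R -> R[i]^o) - (wave_cos c T)%:C *: (u 0 : R -> R[i]^o)
  - (wave_sin c T)%:C *: (u1 0 : R -> R[i]^o).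
have Lw : L2 w.
  by apply: (phB PH); [apply: (phB PH)|] => //; exact: L2Z.
have Le := @L2_eigseq R bc.
pose a n := rip (eigseq bc n) w.
have sum_a N : \sum_(n < N) `|a n| <= K * Num.sqrt H.
  (* Signs suffice as unimodular factors because the real family contains both [e_k] and [i e_k].
     With them [rip z w] equals [\sum |a n|], and Duhamel's bound applies with [b = Num.sqrt H]. *)
  pose z : R -> R[i]^o := \sum_(n < N) (Num.sg (a n))%:C *: eigseq bc n.
  have Lt n : L2 ((Num.sg (a n))%:C *: eigseq bc n) by exact: L2Z.
  have Lz : L2 z by exact: (ph_sum PH).
  have zE g : L2 g -> rip z g = \sum_(n < N) Num.sg (a n) * rip (eigseq bc n) g.
    move=> Lg; rewrite (phB_suml PH) //; apply: eq_bigr => n _.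
    by rewrite (phBZl PH).
  have zw : rip z w = \sum_(n < N) `|a n|.
    by rewrite zE //; apply: eq_bigr => n _; rewrite normrEsg.
  rewrite -zw; apply: le_trans (ler_norm _) _.
  apply: hK => // s.
  rewrite zE //; apply: le_trans (ler_norm_sum _ _ _) _.
  apply: le_trans (ph_bessel_CS PH (ph_orth_eigseq R bc) (Luu s) (hH N)).
  apply: ler_sum => n _; have [hus _] := huP s.
  by rewrite (fun_op_eigseq n hus) normrM normr_sg ler_piMl // lern1 leq_b1.
have [S [cS LS hS]] := absolute_series_L2 sum_a
  (fun n => ccont_eigseq R bc n) (fun n x => sqc_eigseq_le1 bc n x).
exists S; first exact: ccont_continuous.
pose z : R -> R[i]^o := w - S.
have Lz : L2 z by exact: (phB PH).
have ze n : rip z (eigseq bc n) = 0.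
  have [e0|e1] := eigseq_norm R bc n; first by rewrite e0 (phB0r PH).
  rewrite (phBBl PH) // (phC PH w) (phC PH S) -/(a n).
  (* The partial sums of the pairing with [eigseq bc n] equal [a n] as soon as they include the
     index [n], that is from length [n.+1] on. *)
  rewrite (hS _ (a n) n.+1 (Le n)) ?subrr // => N nN.
  rewrite (bigD1 (Ordinal nN)) //= e1 mulr1 big1 ?addr0 // => m mn.
  have [_ oe _] := ph_orth_eigseq R bc.
  by rewrite oe ?mulr0 // eq_sym; apply: contraNneq mn => mn; apply/eqP/val_inj.
have zi i : rip z (eig bc i) = 0 by rewrite -eigseq_pickle.
have zw : rip z w = 0.
  (* As [z] is orthogonal to the range of [h(A)], Duhamel's bound holds with [b = 0]. *)
  apply/eqP; rewrite -normr_le0 -(mulr0 K); apply: hK => // s.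
  have [hus _] := huP s.
  by rewrite (fun_op_orth hus Lz zi) normr0 mul0r.
have zS : rip z S = 0.
  by apply: (hS z 0 0%N Lz) => N _; apply: big1 => n _; rewrite ze mulr0.
have zz : rip z z = 0 by rewrite {2}/z (phBBr PH) // zw zS subrr.
have := rip_eq0 Lz zz.
apply: ae_muIS3 ui vi => x uix vix zx _.
have {}zx := zx I; have {}uix := uix I; have {}vix := vix I.
rewrite cos_sqrt_real sin_sqrt_real -uix -vix.
apply/eqP; rewrite -subr_eq0; apply/eqP; rewrite -[RHS]zx.
rewrite (_ : z x = u T x - (wave_cos c T)%:C * u 0 x -
  (wave_sin c T)%:C * u1 0 x - S x) //.
by rewrite !opprD !addrA.
Qed.

Unset Implicit Arguments.

Theorem mainTheorem12 (R : realType) (bc : boundary_condition) (c : R)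
    (h : R -> R)
    (h_bounded : exists M : R, forall r : R,
       spectrum (opA bc) r%:C -> `|h r| <= M)
    (h_HS : hilbert_schmidt (fun_op bc h))
    (u0 v0 : R -> R[i]) (Lu0 : L2 u0) (Lv0 : L2 v0)
    (u : R -> R -> R[i]) (u_sol : wave_solution bc h c u0 v0 u) :
  (forall t : R, exists2 du : R -> R[i]^o,
     {within `[-1, 1], continuous du} &
     u t = (fun x => cos_sqrt t c%:C * u0 x + sin_sqrt t c%:C * v0 x + du x)
       %[ae muI R]) /\
  (continuous_rep (itvI R) u0 -> continuous_rep (itvI R) v0 ->
   forall t : R, continuous_rep (itvI R) (u t)).
Proof.
have main t := wave_solution_eq (R := R) t h_HS Lu0 Lv0 u_sol.
split=> [t|[g0 cg0 ug0] [g1 cg1 vg1] t]; have [S cS uS] := main t.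
  by exists S => //; exact: continuous_subspaceT.
exists (fun x => cos_sqrt t c%:C * g0 x + sin_sqrt t c%:C * g1 x + S x).
  move=> x; apply: cvgD; last exact: (continuous_subspaceT cS).
  by apply: cvgD; apply: cvgM; [exact: cvg_cst|exact: cg0|exact: cvg_cst|exact: cg1].
apply: ae_muIS3 uS ug0 vg1 => x ux g0x g1x _.
by rewrite ux // g0x // g1x.
Qed.
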